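(* Let $\mathfrak G$ be the $p$-adic Vilenkin group, let $N,M\in\mathbb N$, and let $E\subset\mathfrak G_M^\bot$ be an $(N,M)$-elementary set. Let $\varphi\in L_2(\mathfrak G)$. If $|\hat\varphi(\chi)|=\mathbf 1_E(\chi)$ on $X$, then the system of shifts $(\varphi(x\dot-h))_{h\in H_0}$ is an orthonormal system in $L_2(\mathfrak G)$.
   Context: Let $p$ be a prime. The $p$-adic Vilenkin group $\mathfrak G$ is the set of two-sided sequences $x=(x_k)_{k\in\mathbb Z}$, $x_k\in\{0,\dots,p-1\}$, with only finitely many nonzero $x_k$ with $k<0$, under the operation $\dot+$ of coordinatewise addition modulo $p$ ($\dot-$ is the corresponding subtraction). Put $\mathfrak G_n=\{x: x_k=0 \text{ for } k<n\}$, $n\in\mathbb Z$; these subgroups are a base of neighbourhoods of zero, making $\mathfrak G$ a locally compact abelian group. $\mu$ is the Haar measure with $\mu(\mathfrak G_n)=p^{-n}$. Let $H_0=\{x\in\mathfrak G: x_k=0\text{ for all }k\ge 0\}$. $X$ is the group of (continuous unitary) characters of $\mathfrak G$, written multiplicatively; $(\chi,x)$ is the value of $\chi$ at $x$. $\mathfrak G_n^\bot=\{\chi\in X:(\chi,x)=1\ \forall x\in\mathfrak G_n\}$. The Rademacher characters are $(r_n,x)=\exp(2\pi i x_n/p)$, $n\in\mathbb Z$. $\nu$ is the Haar measure on $X$ with $\nu(\mathfrak G_n^\bot)=p^n$. The Fourier transform is $\hat f(\chi)=\int_{\mathfrak G}f(x)\overline{(\chi,x)}\,d\mu(x)$ for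 $f\in L_2(\mathfrak G)$ (as an $L_2(X)$-limit of the integrals over $\mathfrak G_{-n}$, $n\to\infty$); it is an isometry from $L_2(\mathfrak G)$ onto $L_2(X)$. A set $E\subset X$ is $(N,M)$-elementary if $E$ is a disjoint union of $p^N$ cosets $\mathfrak G_{-N}^\bot\zeta_j$, $\zeta_j=\xi_j\eta_j$, $j=0,\dots,p^N-1$, where $\xi_j=r_{-N}^{\alpha_{-N}}r_{-N+1}^{\alpha_{-N+1}}\cdots r_{-1}^{\alpha_{-1}}$ with $j=\alpha_{-N}+\alpha_{-N+1}p+\dots+\alpha_{-1}p^{N-1}$, and $\eta_j=r_0^{\alpha_0}\cdots r_{M-1}^{\alpha_{M-1}}$ for some exponents depending on $j$ (all exponents $\alpha_\nu\in\{0,\dots,p-1\}$), such that: (1) $\bigsqcup_{j=0}^{p^N-1}\mathfrak G_{-N}^\bot\xi_j=\mathfrak G_0^\bot$ and $\mathfrak G_{-N}^\bot\xi_0=\mathfrak G_{-N}^\bot$; (2) for every $l=0,\dots,M+N-1$, $(\mathfrak G_{-N+l+1}^\bot\setminus\mathfrak G_{-N+l}^\bot)\cap E\neq\emptyset$. *)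

(* Defs.v *)
From HB Require Import structures.
From mathcomp Require Import all_boot all_order all_algebra.
From mathcomp Require Import all_classical all_reals all_analysis.
From mathcomp Require Import complex.
Set Implicit Arguments.
Unset Strict Implicit.
Unset Printing Implicit Defensive.
Import Order.TTheory GRing.Theory Num.Theory.
Import numFieldNormedType.Exports.
Local Open Scope classical_set_scope.
Local Open Scope ring_scope.

(* For p prime 'F_p is {0, ..., p-1} with addition modulo p; the group law on
   [int -> 'F_p] is the pointwise one. *)
Definition vilenkin_pred (p : nat) : {pred int -> 'F_p} :=
  fun x => `[< finite_set [set k : int | k < 0 /\ x k != 0] >].

Lemma vilenkin_zmod_closed (p : nat) : zmod_closed (@vilenkin_pred p).
Proof.
split.
  apply/asboolP; apply: (sub_finite_set _ (@finite_set0 int)) => k [_].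
  by rewrite eqxx.
move=> x y /asboolP fx /asboolP fy; apply/asboolP.
apply: (sub_finite_set _ (_ : finite_set (_ `|` _))); last first.
  by rewrite finite_setU; split; [exact: fx|exact: fy].
move=> k [k0 xyk]; case: (eqVneq (x k) 0) => [xk0|xk]; last by left.
right; split=> //.
by move: xyk; rewrite -[_ k]/(x k - y k) xk0 sub0r oppr_eq0.
Qed.

HB.instance Definition _ (p : nat) :=
  GRing.isZmodClosed.Build (int -> 'F_p) (@vilenkin_pred p)
    (@vilenkin_zmod_closed p).

Record vilenkin (p : nat) : Type := Vilenkin {
  vseq :> int -> 'F_p;
  _ : vseq \in @vilenkin_pred p
}.

HB.instance Definition _ (p : nat) := [isSub for @vseq p].
HB.instance Definition _ (p : nat) := [Choice of vilenkin p by <:].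
HB.instance Definition _ (p : nat) :=
  [SubChoice_isSubZmodule of vilenkin p by <:].
HB.instance Definition _ (p : nat) := isPointed.Build (vilenkin p) 0.

Definition vG (p : nat) (n : int) : set (vilenkin p) :=
  [set x | forall k : int, k < n -> x k = 0].

Definition vH0 (p : nat) : set (vilenkin p) :=
  [set x | forall k : int, 0 <= k -> x k = 0].
Arguments vH0 : clear implicits.

Definition vilenkin_nbhs (p : nat) (x : vilenkin p) : set_system (vilenkin p) :=
  filter_from [set: int] (fun n => [set x + y | y in vG n]).

Lemma vG0 (p : nat) n : vG n (0 : vilenkin p).
Proof. by []. Qed.

Lemma vGD (p : nat) n (x y : vilenkin p) : vG n x -> vG n y -> vG n (x + y).
Proof. by move=> xn yn k kn; rewrite [LHS]/= fctE /= xn ?yn ?addr0. Qed.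

Lemma vG_le (p : nat) (m n : int) (x : vilenkin p) :
  m <= n -> vG n x -> vG m x.
Proof. by move=> mn xn k km; apply: xn; exact: lt_le_trans km mn. Qed.

Lemma vilenkin_nbhs_filter (p : nat) (x : vilenkin p) :
  ProperFilter (vilenkin_nbhs x).
Proof.
apply: filter_from_proper; last by move=> n _; exists (x + 0), 0.
apply: filter_from_filter; first by exists 0.
move=> m n _ _; exists (Num.max m n) => // _ [y yP <-].
by split; exists y => //; apply: vG_le yP; rewrite le_max lexx ?orbT.
Qed.

Lemma vilenkin_nbhs_singleton (p : nat) (x : vilenkin p) A :
  vilenkin_nbhs x A -> A x.
Proof. by move=> [n _ +]; apply; exists 0; rewrite ?addr0. Qed.

Lemma vilenkin_nbhs_nbhs (p : nat) (x : vilenkin p) A :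
  vilenkin_nbhs x A -> vilenkin_nbhs x (fun y => vilenkin_nbhs y A).
Proof.
move=> [n _ xnA]; exists n => // _ [y yn <-]; exists n => // _ [z zn <-].
by apply: xnA; exists (y + z); rewrite ?addrA//; exact: vGD.
Qed.

HB.instance Definition _ (p : nat) :=
  hasNbhs.Build (vilenkin p) (@vilenkin_nbhs p).
HB.instance Definition _ (p : nat) :=
  Nbhs_isNbhsTopological.Build (vilenkin p) (fun x => vilenkin_nbhs_filter x)
    (fun x A => @vilenkin_nbhs_singleton p x A)
    (fun x A => @vilenkin_nbhs_nbhs p x A).

Record character (R : realType) (p : nat) : Type := Character {
  chi_fun :> vilenkin p -> R[i];
  chi_add : forall x y, chi_fun (x + y) = chi_fun x * chi_fun y;
  chi_norm : forall x, `|chi_fun x| = 1;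
  chi_continuous : continuous (chi_fun : vilenkin p -> R[i]^o)
}.

HB.instance Definition _ (R : realType) (p : nat) := gen_eqMixin (character R p).
HB.instance Definition _ (R : realType) (p : nat) :=
  gen_choiceMixin (character R p).

Section CharacterGroup.
Variables (R : realType) (p : nat).
Implicit Types chi psi : character R p.

Lemma characterP chi psi : chi =1 psi -> chi = psi.
Proof.
case: chi psi => [f fD fn fc] [g gD gn gc] /= /funext fg.
by rewrite fg in fD fn fc *; congr Character; exact: Prop_irrelevance.
Qed.

Lemma chi_neq0 chi x : chi x != 0.
Proof. by rewrite -normr_eq0 chi_norm oner_eq0. Qed.

Definition chi_one : character R p.
Proof.
apply: (@Character R p (fun=> 1)).
- by move=> *; rewrite mulr1.
- by move=> *; rewrite normr1.
- exact: (@cst_continuous (vilenkin p) R[i]^o 1).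
Defined.

Definition chi_mul chi psi : character R p.
Proof.
apply: (@Character R p (fun x => chi x * psi x)).
- by move=> x y; rewrite !chi_add mulrACA.
- by move=> x; rewrite normrM !chi_norm mulr1.
- by move=> x; exact: (@cvgM R[i] _ (nbhs x) _ chi psi _ _
    (@chi_continuous _ _ chi x) (@chi_continuous _ _ psi x)).
Defined.

Definition chi_inv chi : character R p.
Proof.
apply: (@Character R p (fun x => (chi x)^-1)).
- by move=> x y; rewrite chi_add invfM.
- by move=> x; rewrite normfV chi_norm invr1.
- by move=> x; exact: (@cvgV R[i] _ (nbhs x) _ chi _
    (chi_neq0 chi x) (@chi_continuous _ _ chi x)).
Defined.

Lemma chi_mulA : associative chi_mul.
Proof. by move=> a b c; apply: characterP => x /=; rewrite mulrA. Qed.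

Lemma chi_mul1 : left_id chi_one chi_mul.
Proof. by move=> a; apply: characterP => x /=; rewrite mul1r. Qed.

Lemma chi_mulr1 : right_id chi_one chi_mul.
Proof. by move=> a; apply: characterP => x /=; rewrite mulr1. Qed.

Lemma chi_mulV : left_inverse chi_one chi_inv chi_mul.
Proof. by move=> a; apply: characterP => x /=; rewrite mulVf// chi_neq0. Qed.

Lemma chi_mulrV : right_inverse chi_one chi_inv chi_mul.
Proof. by move=> a; apply: characterP => x /=; rewrite mulfV// chi_neq0. Qed.

End CharacterGroup.

HB.instance Definition _ (R : realType) (p : nat) :=
  isGroup.Build (character R p) (@chi_mulA R p) (@chi_mul1 R p)
    (@chi_mulr1 R p) (@chi_mulV R p) (@chi_mulrV R p).
HB.instance Definition _ (R : realType) (p : nat) :=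
  isPointed.Build (character R p) 1%g.

(* The topology of the Pontryagin dual: uniform convergence on compact sets. *)
HB.instance Definition _ (R : realType) (p : nat) :=
  Topological.copy (character R p)
    (initial_topology
      (@chi_fun R p : character R p -> {compact-open, vilenkin p -> R[i]^o})).

Definition annihilator (R : realType) (p : nat) (n : int) :
    set (character R p) :=
  [set chi | forall x, vG n x -> chi x = 1].
Arguments annihilator : clear implicits.

Definition coset_char (R : realType) (p : nat) (H : set (character R p))
    (z : character R p) : set (character R p) := [set (chi * z)%g | chi in H].

Definition disjoint_union (J T : Type) (F : J -> set T) (E : set T) : Prop :=
  trivIset [set: J] F /\ \bigcup_j F j = E.

Section Rademacher.
Variables (R : realType) (p : nat).
Hypothesis p_prime : prime p.

(* exp (i t) *)
Definition expi (t : R) : R[i] := Complex (cos t) (sin t).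

Lemma expiD s t : expi (s + t) = expi s * expi t.
Proof. by rewrite /expi cosD sinD; congr Complex; rewrite addrC. Qed.

Lemma expi2pi n : expi (2 * pi * n%:R) = 1.
Proof.
have e1 : expi (2 * pi) = 1 by rewrite /expi mulr_natl cos2pi sin2pi.
elim: n => [|n IHn]; first by rewrite mulr0 /expi cos0 sin0.
by rewrite -[n.+1%:R]natr1 mulrDr expiD IHn mul1r mulr1 e1.
Qed.

Lemma norm_expi t : `|expi t| = 1.
Proof. by rewrite normc_def /= cos2Dsin2 sqrtr1. Qed.

Definition rademacher_fun (n : int) (x : vilenkin p) : R[i] :=
  expi (2 * pi * (x n : nat)%:R / p%:R).

Lemma rademacherD n x y :
  rademacher_fun n (x + y) = rademacher_fun n x * rademacher_fun n y.
Proof.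
have p0 : p%:R != 0 :> R by rewrite pnatr_eq0 -lt0n prime_gt0.
rewrite /rademacher_fun -expiD -mulrDl -mulrDr -natrD.
have -> : (x + y)%R n = ((x n + y n) %% p)%N :> nat.
  exact: (congr1 (modn (x n + y n)) (Fp_cast p_prime)).
set m := (x n + y n)%N.
have -> : 2 * pi * m%:R / p%:R =
    2 * pi * (m %% p)%:R / p%:R + 2 * pi * (m %/ p)%:R :> R.
  rewrite {1}(divn_eq m p) natrD natrM mulrDr mulrDl addrC mulrA.
  by rewrite mulfK.
by rewrite expiD expi2pi mulr1.
Qed.

Lemma rademacher_norm n x : `|rademacher_fun n x| = 1.
Proof. exact: norm_expi. Qed.

Lemma rademacher_continuous n :
  continuous (rademacher_fun n : vilenkin p -> R[i]^o).
Proof.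
move=> x; apply: (@near_cst_continuous (vilenkin p) R[i]^o (rademacher_fun n x)).
exists (n + 1) => // _ [y yn <-] /=.
by rewrite /rademacher_fun -[(x + y) n]/(x n + y n) yn ?addr0// ltrDl.
Qed.

Definition rademacher (n : int) : character R p :=
  Character (@rademacherD n) (@rademacher_norm n) (@rademacher_continuous n).

Definition elementary_xi (N : nat) (a : 'I_N -> 'I_p) : character R p :=
  (\prod_(i < N) rademacher (- N%:Z + (i : nat)%:Z) ^+ a i)%g.

Definition elementary_eta (M : nat) (b : 'I_M -> 'I_p) : character R p :=
  (\prod_(i < M) rademacher (i : nat)%:Z ^+ b i)%g.

(* [a j i] is the exponent of r_(-N + i) in xi_j, i.e. the i-th base-p digit of
   j, and [b j i] is the exponent of r_i in eta_j. *)
Definition elementary (N M : nat) (E : set (character R p)) : Prop :=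
  exists (a : 'I_(p ^ N) -> 'I_N -> 'I_p) (b : 'I_(p ^ N) -> 'I_M -> 'I_p),
    let xi j := elementary_xi (a j) in
    let eta j := elementary_eta (b j) in
    let ann n := annihilator R p n in
    [/\ forall j : 'I_(p ^ N), j = (\sum_(i < N) a j i * p ^ i)%N :> nat,
        disjoint_union (fun j => coset_char (ann (- N%:Z)) (xi j * eta j)%g) E,
        disjoint_union (fun j => coset_char (ann (- N%:Z)) (xi j)) (ann 0),
        forall j0 : 'I_(p ^ N), j0 = 0%N :> nat ->
          coset_char (ann (- N%:Z)) (xi j0) = ann (- N%:Z) &
        forall l : nat, (l < M + N)%N ->
          (ann (- N%:Z + l%:Z + 1) `\` ann (- N%:Z + l%:Z)) `&` E !=set0].

End Rademacher.

Definition borel (T : ptopologicalType) := g_sigma_algebraType (@open T).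

(* Both groups are locally compact, second countable: a translation-invariant
   Borel measure that is finite and positive on the open compact subgroups below
   is automatically regular, so these conditions determine the Haar measure. *)
Definition haarG (R : realType) (p : nat)
    (mu : {measure set (borel (vilenkin p)) -> \bar R}) : Prop :=
  (forall (a : vilenkin p) (A : set (borel (vilenkin p))), measurable A ->
     mu [set a + x | x in A] = mu A) /\
  (forall n : int, mu (vG n) = ((p%:R : R) ^ (- n))%:E).

Definition haarX (R : realType) (p : nat)
    (nu : {measure set (borel (character R p)) -> \bar R}) : Prop :=
  (forall (psi : character R p) (A : set (borel (character R p))),
     measurable A -> nu [set (psi * chi)%g | chi in A] = nu A) /\
  (forall n : int, nu (annihilator R p n) = ((p%:R : R) ^ n)%:E).

Section ComplexL2.
Context (R : realType) (d : measure_display) (T : measurableType d).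
Variable m : {measure set T -> \bar R}.

(* Elements of L2 are handled through representatives. *)
Definition memL2 (f : T -> R[i]) : Prop :=
  [/\ measurable_fun setT (fun x => complex.Re (f x)),
      measurable_fun setT (fun x => complex.Im (f x)) &
      (\int[m]_x ((complex.Re `|f x|) ^+ 2)%:E < +oo)%E].

Definition cintegral (D : set T) (f : T -> R[i]) : R[i] :=
  Complex (\int[m]_(x in D) complex.Re (f x)) (\int[m]_(x in D) complex.Im (f x)).

Definition inner2 (f g : T -> R[i]) : R[i] :=
  cintegral setT (fun x => f x * (g x)^*).

Definition orthonormal_system (I : choiceType) (D : set I)
    (f : I -> T -> R[i]) : Prop :=
  (forall i, D i -> memL2 (f i)) /\
  (forall i j, D i -> D j -> inner2 (f i) (f j) = (i == j)%:R).

End ComplexL2.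

(* [fhat] is (a representative of) the Fourier transform of [f]: the L2-limit
   of the integrals over G_(-n). *)
Definition is_fourier (R : realType) (p : nat)
    (mu : {measure set (borel (vilenkin p)) -> \bar R})
    (nu : {measure set (borel (character R p)) -> \bar R})
    (f : vilenkin p -> R[i]) (fhat : character R p -> R[i]) : Prop :=
  memL2 nu fhat /\
  (fun n : nat => \int[nu]_chi ((complex.Re `|fhat chi -
     cintegral mu (vG (- n%:Z)) (fun x => f x * (chi x)^*)|) ^+ 2)%:E)%E
   @ \oo --> 0%E.

(* Main.v *)
From HB Require Import structures.
From mathcomp Require Import all_boot all_order all_algebra.
From mathcomp Require Import all_classical all_reals all_analysis.
From mathcomp Require Import measurable_realfun complex ring lra zify.
Require Import Defs.
Set Implicit Arguments.
Unset Strict Implicit.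
Unset Printing Implicit Defensive.
Import Order.TTheory GRing.Theory Num.Theory.
Import numFieldNormedType.Exports.
Local Open Scope classical_set_scope.
Local Open Scope ring_scope.

(** Write G_n^perp for the annihilator of G_n.  The inner product of two shifts
    of phi is, after a translation, the correlation of phi with its shift by
    some u in H_0, and by Plancherel this is the integral over X of
    |phihat(chi)|^2 chi(u), that is, of chi(u) over E
    (lemma [correlation_spectral]).

    The integral over E is then computed coset by coset
    ([cintegral_char_elementary]).  Over a coset of G_{-N}^perp the function
    chi |-> chi(u) is constant if u lies in G_{-N}; otherwise its integral is 0,
    since some character of G_{-N}^perp differs from 1 at u
    ([cintegral_char_coset]).  As the eta_j involve only the r_i with i >= 0,
    they are 1 on H_0, so that xi_j eta_j and xi_j contribute equally: E may be
    replaced by the union of the cosets of the xi_j, which is G_0^perp.  The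
    integral of chi(u) over G_0^perp is 1 if u lies in G_0 and 0 otherwise, and
    H_0 meets G_0 only in 0.

    The form of Plancherel needed here takes advantage of the fact that phihat
    vanishes outside G_M^perp.  Let F_n be the Fourier transform of phi cut off
    to G_{-n}.  On G_k^perp it is a finite linear combination of evaluations
    chi |-> chi(-t), the coefficients being the integrals of phi over the cosets
    t + G_k inside G_{-n} ([partial_fourierE]).  Pairing F_n with chi(z) over
    G_k^perp therefore gives p^k times the integral of phi over z + G_k as soon
    as n is large, and since F_n tends to phihat in L2, the pairing of phihat
    with chi(z) over G_k^perp has the same value ([fourier_inversion]).  For
    k >= M this value does not depend on k: all the averages of phi over the
    balls inside y + G_M agree.  The balls are stable under intersection and
    generate the Borel sets, hence phi is almost everywhere constant on y + G_M
    ([phi_locally_constant]).  The correlation of phi with its shift over G_{-n}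
    thus becomes a finite sum, which is exactly the pairing of F_n with
    conj(phihat(chi)) chi(u) over G_M^perp ([windowed_correlation]); the identity
    wanted is the limit of this equality as n tends to infinity. *)

(** * Real and imaginary parts *)
Section ComplexParts.
Context {R : realType}.
Implicit Types z w : R[i].

Lemma cReD z w : complex.Re (z + w) = complex.Re z + complex.Re w.
Proof. by case: z w => [a b] [c d]. Qed.

Lemma cImD z w : complex.Im (z + w) = complex.Im z + complex.Im w.
Proof. by case: z w => [a b] [c d]. Qed.

Lemma cReN z : complex.Re (- z) = - complex.Re z.
Proof. by case: z. Qed.

Lemma cImN z : complex.Im (- z) = - complex.Im z.
Proof. by case: z. Qed.

Lemma cReM z w : complex.Re (z * w) =
  complex.Re z * complex.Re w - complex.Im z * complex.Im w.
Proof. by case: z w => [a b] [c d]. Qed.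

Lemma cImM z w : complex.Im (z * w) =
  complex.Re z * complex.Im w + complex.Im z * complex.Re w.
Proof. by case: z w => [a b] [c d]. Qed.

Lemma cRe_conj z : complex.Re (z^*) = complex.Re z.
Proof. by case: z. Qed.

Lemma cIm_conj z : complex.Im (z^*) = - complex.Im z.
Proof. by case: z. Qed.

Lemma complex_eq z w :
  complex.Re z = complex.Re w -> complex.Im z = complex.Im w -> z = w.
Proof. by case: z w => [a b] [c d] /= -> ->. Qed.

(** The squared modulus as a real number: unlike the modulus it is polynomial in
    the real and imaginary parts, hence measurable without further ado. *)
Definition sqn z : R := complex.Re z ^+ 2 + complex.Im z ^+ 2.

Lemma sqn_ge0 z : 0 <= sqn z.
Proof. by rewrite addr_ge0// sqr_ge0. Qed.

Lemma sqnE z : complex.Re `|z| ^+ 2 = sqn z.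
Proof. by rewrite normc_def /= sqr_sqrtr// sqn_ge0. Qed.

Lemma sqn_norm z : `|z| ^+ 2 = (sqn z)%:C%C.
Proof. by rewrite -add_Re2_Im2. Qed.

Lemma sqn_conj z : sqn z^* = sqn z.
Proof. by rewrite /sqn cRe_conj cIm_conj sqrrN. Qed.

Lemma sqnM z w : sqn (z * w) = sqn z * sqn w.
Proof. by rewrite /sqn cReM cImM; ring. Qed.

Lemma sqnD z w : sqn (z + w) <= 2 * (sqn z + sqn w).
Proof.
rewrite /sqn cReD cImD; set a := complex.Re z; set b := complex.Im z.
set c := complex.Re w; set d := complex.Im w.
have := sqr_ge0 (a - c); have := sqr_ge0 (b - d); nra.
Qed.

Lemma mulr_conj_sqn z : z * z^* = (sqn z)%:C%C.
Proof. by apply: complex_eq; rewrite ?cReM ?cImM cRe_conj cIm_conj /= /sqn; ring. Qed.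

(** Young's inequality for each product of parts.  The free weight [e] is what
    makes a pairing small when one factor is small and the other one is only
    bounded. *)
Lemma Re_mul_le z w (e : R) : 0 < e ->
  `|complex.Re (z * w)| <= e^-1 * sqn z + e * sqn w.
Proof.
move=> e0; rewrite cReM /sqn; set a := complex.Re z; set b := complex.Im z.
set c := complex.Re w; set d := complex.Im w.
have young (x y : R) : `|x * y| <= e^-1 * x ^+ 2 + e * y ^+ 2.
  have h1 := sqr_ge0 (x - e * y); have h2 := sqr_ge0 (x + e * y).
  rewrite -subr_ge0.
  have -> : e^-1 * x ^+ 2 + e * y ^+ 2 - `|x * y| =
     e^-1 * (x ^+ 2 + e ^+ 2 * y ^+ 2 - e * `|x * y|) by field; rewrite gt_eqF.
  apply: mulr_ge0; first by rewrite invr_ge0 ltW.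
  have p1 := sqr_ge0 x; have p2 := sqr_ge0 (e * y).
  by have [xy|xy] := leP 0 (x * y); rewrite ?(ger0_norm xy) ?(ltr0_norm xy); nra.
apply: (le_trans (ler_normB _ _)).
by have := young a c; have := young b d; lra.
Qed.

Lemma Im_mul_le z w (e : R) : 0 < e ->
  `|complex.Im (z * w)| <= e^-1 * sqn z + e * sqn w.
Proof.
move=> e0; have -> : complex.Im (z * w) = - complex.Re (z * (w * 'i%C)).
  by rewrite mulrA ReiNIm opprK.
rewrite normrN; apply: (le_trans (Re_mul_le z (w * 'i%C) e0)).
by rewrite sqnM {3}/sqn /= expr0n expr1n add0r mulr1.
Qed.

Lemma normc_ge_Im z : (`|complex.Im z|%:C)%C <= `|z|.
Proof.
have := normc_ge_Re (z * 'i%C); rewrite ReiNIm normrN normrM.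
by rewrite [`|'i%C|]normc_def /= expr0n expr1n add0r sqrtr1 mulr1.
Qed.

End ComplexParts.

(** * Integration of complex functions *)
Section ComplexIntegral.
Context {R : realType} {d : measure_display} {T : measurableType d}.
Variable m : {measure set T -> \bar R}.
Implicit Types (D : set T) (f g : T -> R[i]).

Definition cmeasurable D f :=
  measurable_fun D (fun x => complex.Re (f x)) /\
  measurable_fun D (fun x => complex.Im (f x)).

Definition cintegrable D f :=
  m.-integrable D (EFin \o (fun x => complex.Re (f x))) /\
  m.-integrable D (EFin \o (fun x => complex.Im (f x))).

Definition sq_integrable D f :=
  cmeasurable D f /\ m.-integrable D (EFin \o (fun x => sqn (f x))).

Lemma cmeasurable_cst D c : cmeasurable D (fun=> c).
Proof. by split; exact: measurable_cst. Qed.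

Lemma cmeasurableD {D f g} : cmeasurable D f -> cmeasurable D g ->
  cmeasurable D (fun x => f x + g x).
Proof.
move=> [f1 f2] [g1 g2]; split.
  by under eq_fun do rewrite cReD; exact: measurable_funD.
by under eq_fun do rewrite cImD; exact: measurable_funD.
Qed.

Lemma cmeasurableN {D f} : cmeasurable D f -> cmeasurable D (fun x => - f x).
Proof.
move=> [f1 f2]; split.
  by under eq_fun do rewrite cReN; exact: measurableT_comp.
by under eq_fun do rewrite cImN; exact: measurableT_comp.
Qed.

Lemma cmeasurableM {D f g} : cmeasurable D f -> cmeasurable D g ->
  cmeasurable D (fun x => f x * g x).
Proof.
move=> [f1 f2] [g1 g2]; split.
  by under eq_fun do rewrite cReM; apply: measurable_funB; exact: measurable_funM.
by under eq_fun do rewrite cImM; apply: measurable_funD; exact: measurable_funM.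
Qed.

Lemma cmeasurable_conj {D f} : cmeasurable D f ->
  cmeasurable D (fun x => (f x)^*).
Proof.
move=> [f1 f2]; split; first by under eq_fun do rewrite cRe_conj.
by under eq_fun do rewrite cIm_conj; exact: measurableT_comp.
Qed.

Lemma cmeasurableS {D D' f} : measurable D -> D' `<=` D ->
  cmeasurable D f -> cmeasurable D' f.
Proof. by move=> mD sD [f1 f2]; split; exact: (measurable_funS mD). Qed.

Lemma measurable_sqn {D f} : cmeasurable D f ->
  measurable_fun D (fun x => sqn (f x)).
Proof. by move=> [f1 f2]; apply: measurable_funD; exact: measurable_funX. Qed.

Lemma cintegrable_le D f (h : T -> R) : measurable D -> cmeasurable D f ->
  m.-integrable D (EFin \o h) ->
  (forall x, D x -> `|complex.Re (f x)| <= h x) ->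
  (forall x, D x -> `|complex.Im (f x)| <= h x) -> cintegrable D f.
Proof.
move=> mD [f1 f2] ih hr hi; split; apply: (le_integrable mD _ _ ih) => //.
- exact/measurable_EFinP.
- by move=> x Dx; rewrite /= lee_fin (le_trans (hr x Dx))// ler_norm.
- exact/measurable_EFinP.
- by move=> x Dx; rewrite /= lee_fin (le_trans (hi x Dx))// ler_norm.
Qed.

Lemma rintegrable_cst D (c : R) : measurable D -> (m D < +oo)%E ->
  m.-integrable D (EFin \o (fun=> c)).
Proof.
move=> mD fD; apply: measurable_bounded_integrable => //.
exact: bounded_cst.
Qed.

Lemma cintegrable_bounded D f (B : R) : measurable D -> (m D < +oo)%E ->
  cmeasurable D f -> (forall x, D x -> sqn (f x) <= B) -> cintegrable D f.
Proof.
move=> mD fD mf fB.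
have p (a b : R) : `|a| <= 1 + (a ^+ 2 + b ^+ 2).
  have := sqr_ge0 b; have := sqr_ge0 (a - 1); have := sqr_ge0 (a + 1).
  by have [h|h] := leP 0 a; rewrite ?(ger0_norm h) ?(ltr0_norm h); nra.
apply: (cintegrable_le mD mf (rintegrable_cst (1 + B) mD fD)) => x Dx.
  by rewrite (le_trans (p _ (complex.Im (f x))))// lerD2l; exact: fB.
by rewrite (le_trans (p _ (complex.Re (f x))))// lerD2l addrC; exact: fB.
Qed.

Lemma cintegrable_cst D (c : R[i]) : measurable D -> (m D < +oo)%E ->
  cintegrable D (fun=> c).
Proof.
by move=> mD fD; apply: (@cintegrable_bounded _ _ (sqn c)).
Qed.

Lemma cintegrable_measurable {D f} : measurable D -> cintegrable D f ->
  cmeasurable D f.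
Proof.
by move=> mD [/measurable_int/measurable_EFinP f1
  /measurable_int/measurable_EFinP f2].
Qed.

Lemma cintegrableD {D f g} : measurable D ->
  cintegrable D f -> cintegrable D g -> cintegrable D (fun x => f x + g x).
Proof.
move=> mD [f1 f2] [g1 g2]; split.
  under eq_fun do rewrite cReD.
  exact: (integrableD mD f1 g1).
under eq_fun do rewrite cImD.
exact: (integrableD mD f2 g2).
Qed.

Lemma rintegrableZ {D} {h : T -> R} (a : R) : measurable D ->
  m.-integrable D (EFin \o h) -> m.-integrable D (EFin \o (fun x => a * h x)).
Proof. by move=> mD ih; exact: (integrableZl mD a ih). Qed.

Lemma cintegrableZ {D f} (c : R[i]) : measurable D -> cintegrable D f ->
  cintegrable D (fun x => c * f x).
Proof.
move=> mD [f1 f2]; split.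
  under eq_fun do rewrite cReM.
  exact: (integrableB mD (rintegrableZ _ mD f1) (rintegrableZ _ mD f2)).
under eq_fun do rewrite cImM.
exact: (integrableD mD (rintegrableZ _ mD f2) (rintegrableZ _ mD f1)).
Qed.

Lemma cintegrableS {D D' f} : measurable D -> measurable D' -> D' `<=` D ->
  cintegrable D f -> cintegrable D' f.
Proof.
by move=> mD mD' sD [f1 f2]; split; [exact: integrableS f1|exact: integrableS f2].
Qed.

Lemma sq_integrableS {D D' f} : measurable D -> measurable D' -> D' `<=` D ->
  sq_integrable D f -> sq_integrable D' f.
Proof.
by move=> mD mD' sD [f1 f2]; split; [exact: cmeasurableS f1|exact: integrableS f2].
Qed.

Lemma sq_integrable_bounded D f (B : R) : measurable D -> (m D < +oo)%E ->
  cmeasurable D f -> (forall x, D x -> sqn (f x) <= B) -> sq_integrable D f.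
Proof.
move=> mD fD mf fB; split => //.
apply: (le_integrable mD _ _ (rintegrable_cst B mD fD)).
  by apply/measurable_EFinP; exact: measurable_sqn.
move=> x Dx; rewrite /= lee_fin ger0_norm ?sqn_ge0//.
by rewrite ger0_norm ?fB// (le_trans (sqn_ge0 _) (fB _ Dx)).
Qed.

Lemma sq_integrable_conj {D f} : sq_integrable D f ->
  sq_integrable D (fun x => (f x)^*).
Proof.
move=> [f1 f2]; split; first exact: cmeasurable_conj.
by under eq_fun do rewrite sqn_conj.
Qed.

Lemma sq_integrableM_bounded {D f} h (B : R) : measurable D -> cmeasurable D h ->
  (forall x, D x -> sqn (h x) <= B) -> sq_integrable D f ->
  sq_integrable D (fun x => f x * h x).
Proof.
move=> mD mh hB [f1 f2]; split; first exact: cmeasurableM.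
apply: (le_integrable mD _ _ (rintegrableZ B mD f2)).
  by apply/measurable_EFinP/measurable_sqn; exact: cmeasurableM.
move=> x Dx; rewrite /= lee_fin !ger0_norm ?sqn_ge0//.
  by rewrite sqnM mulrC ler_wpM2r ?sqn_ge0// hB.
by rewrite mulr_ge0 ?sqn_ge0// (le_trans (sqn_ge0 _) (hB _ Dx)).
Qed.

Lemma sq_integrableN {D f} : sq_integrable D f ->
  sq_integrable D (fun x => - f x).
Proof.
move=> [f1 f2]; split; first exact: cmeasurableN.
by under eq_fun do rewrite /sqn cReN cImN !sqrrN.
Qed.

Lemma sq_integrableD {D f g} : measurable D -> sq_integrable D f ->
  sq_integrable D g -> sq_integrable D (fun x => f x + g x).
Proof.
move=> mD [f1 f2] [g1 g2]; have mfg := cmeasurableD f1 g1.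
split => //; have := rintegrableZ 2 mD (integrableD mD f2 g2).
apply: le_integrable => //; first by apply/measurable_EFinP; exact: measurable_sqn.
move=> x Dx; rewrite /= lee_fin !ger0_norm ?sqn_ge0//; first exact: sqnD.
by rewrite mulr_ge0 // addr_ge0 ?sqn_ge0.
Qed.

Lemma sq_integrableB {D f g} : measurable D -> sq_integrable D f ->
  sq_integrable D g -> sq_integrable D (fun x => f x - g x).
Proof. by move=> mD fi gi; apply: sq_integrableD => //; exact: sq_integrableN. Qed.

Lemma eq_sq_integrable D f g : measurable D -> (forall x, D x -> f x = g x) ->
  sq_integrable D f -> sq_integrable D g.
Proof.
move=> mD fg [[f1 f2] f3]; have fgE : {in D, f =1 g} by move=> x /set_mem/fg.
split; first split.
- by apply: eq_measurable_fun f1 => x xD; rewrite fgE.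
- by apply: eq_measurable_fun f2 => x xD; rewrite fgE.
- by apply: eq_integrable f3 => // x xD; rewrite /= fgE.
Qed.

Lemma sq_integrable_sum (I : Type) (s : seq I) D (f : I -> T -> R[i]) :
  measurable D -> (m D < +oo)%E -> (forall i, sq_integrable D (f i)) ->
  sq_integrable D (fun x => \sum_(i <- s) f i x).
Proof.
move=> mD fD fi; elim: s => [|i s IH].
  under eq_fun do rewrite big_nil.
  by apply: (@sq_integrable_bounded _ _ (sqn 0)) => //; exact: cmeasurable_cst.
by under eq_fun do rewrite big_cons; exact: sq_integrableD.
Qed.

Lemma cintegrableM {D f g} : measurable D -> sq_integrable D f ->
  sq_integrable D g -> cintegrable D (fun x => f x * g x).
Proof.
move=> mD [f1 f2] [g1 g2].
apply: (cintegrable_le mD (cmeasurableM f1 g1) (integrableD mD f2 g2)) => x Dx /=.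
  by have := Re_mul_le (f x) (g x) (@ltr01 R); rewrite invr1 !mul1r.
by have := Im_mul_le (f x) (g x) (@ltr01 R); rewrite invr1 !mul1r.
Qed.

Lemma sq_integrable_cintegrable {D f} : measurable D -> (m D < +oo)%E ->
  sq_integrable D f -> cintegrable D f.
Proof.
move=> mD fD sf; have s1 : sq_integrable D (fun=> 1).
  apply: (@sq_integrable_bounded _ _ (sqn 1)) => //; exact: cmeasurable_cst.
have := cintegrableM mD sf s1.
by rewrite (_ : (fun x => f x * 1) = f)//; apply/funext => x; rewrite mulr1.
Qed.

Lemma eq_cintegral D f g : (forall x, D x -> f x = g x) ->
  cintegral m D f = cintegral m D g.
Proof.
by move=> fg; rewrite /cintegral; congr Complex; apply: eq_Rintegral => x /set_mem Dx;
  rewrite fg.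
Qed.

Lemma cintegralD D f g : measurable D -> cintegrable D f -> cintegrable D g ->
  cintegral m D (fun x => f x + g x) = cintegral m D f + cintegral m D g.
Proof.
move=> mD [f1 f2] [g1 g2]; rewrite /cintegral; apply: complex_eq; rewrite ?cReD ?cImD /=.
  by under eq_Rintegral do rewrite cReD; rewrite RintegralD.
by under eq_Rintegral do rewrite cImD; rewrite RintegralD.
Qed.

Lemma cintegralZ D f (c : R[i]) : measurable D -> cintegrable D f ->
  cintegral m D (fun x => c * f x) = c * cintegral m D f.
Proof.
move=> mD [f1 f2]; apply: complex_eq; rewrite ?cReM ?cImM /=.
  under eq_Rintegral do rewrite cReM.
  by rewrite RintegralB ?RintegralZl//; exact: rintegrableZ.
under eq_Rintegral do rewrite cImM.
by rewrite RintegralD ?RintegralZl//; exact: rintegrableZ.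
Qed.

Lemma cintegral_conj D f : measurable D -> cintegrable D f ->
  cintegral m D (fun x => (f x)^*) = (cintegral m D f)^*.
Proof.
move=> mD [f1 f2]; apply: complex_eq; rewrite ?cRe_conj ?cIm_conj /=.
  by under eq_Rintegral do rewrite cRe_conj.
under eq_Rintegral do rewrite cIm_conj -mulN1r.
by rewrite RintegralZl// mulN1r.
Qed.

Lemma cintegral_cst D (c : R[i]) : measurable D ->
  cintegral m D (fun=> c) = c * (fine (m D))%:C%C.
Proof.
move=> mD; apply: complex_eq; rewrite ?cReM ?cImM /= Rintegral_cst// mulr0.
  by rewrite subr0.
by rewrite add0r.
Qed.

Lemma cintegrable_sum (I : eqType) (s : seq I) D (f : I -> T -> R[i]) :
  measurable D -> (m D < +oo)%E -> (forall i, cintegrable D (f i)) ->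
  cintegrable D (fun x => \sum_(i <- s) f i x).
Proof.
move=> mD fD fi; elim: s => [|i s IH].
  under eq_fun do rewrite big_nil.
  exact: cintegrable_cst.
by under eq_fun do rewrite big_cons; exact: cintegrableD.
Qed.

Lemma cintegral_sum (I : eqType) (s : seq I) D (f : I -> T -> R[i]) :
  measurable D -> (m D < +oo)%E -> (forall i, cintegrable D (f i)) ->
  cintegral m D (fun x => \sum_(i <- s) f i x) = \sum_(i <- s) cintegral m D (f i).
Proof.
move=> mD fD fi; elim: s => [|i s IH].
  under eq_cintegral do rewrite big_nil.
  by rewrite cintegral_cst// mul0r big_nil.
under eq_cintegral do rewrite big_cons.
by rewrite cintegralD ?IH ?big_cons//; exact: cintegrable_sum.
Qed.

Lemma ae_eq_cintegral D f g : measurable D -> cmeasurable D f ->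
  cmeasurable D g -> {ae m, forall x, D x -> f x = g x} ->
  cintegral m D f = cintegral m D g.
Proof.
move=> mD [f1 f2] [g1 g2] fg; rewrite /cintegral /Rintegral.
congr (Complex (fine _) (fine _)); apply: ae_eq_integral => //;
  try exact/measurable_EFinP; apply: filterS fg => x /[apply] -> //.
Qed.

Lemma Rintegral_bigcup_fin (I : finType) (F : I -> set T) (h : T -> R) :
  (forall i, measurable (F i)) -> trivIset setT F ->
  m.-integrable (\bigcup_i F i) (EFin \o h) ->
  \int[m]_(x in \bigcup_i F i) h x = \sum_i \int[m]_(x in F i) h x.
Proof.
move=> mF tF ih.
have eU : \bigcup_i F i = \big[setU/set0]_(i <- index_enum I) F i.
  rewrite -bigcup_seq; apply: eq_bigcupl; split => i //= _.
  by rewrite mem_index_enum.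
have ihF i : m.-integrable (F i) (EFin \o h).
  apply: integrableS ih => //; last exact: bigcup_sup.
  by rewrite eU; exact: bigsetU_measurable.
rewrite /Rintegral eU integral_bigsetU_EFin//.
- by rewrite -sum_fine// => i _; exact: integrable_fin_num.
- exact: index_enum_uniq.
- by apply: sub_trivIset tF.
- by rewrite -eU; exact: measurable_int ih.
Qed.

Lemma cintegral_bigcup_fin (I : finType) (F : I -> set T) f :
  (forall i, measurable (F i)) -> trivIset setT F ->
  cintegrable (\bigcup_i F i) f ->
  cintegral m (\bigcup_i F i) f = \sum_i cintegral m (F i) f.
Proof.
move=> mF tF [f1 f2].
have -> : \sum_i cintegral m (F i) f = Complex
    (\sum_i \int[m]_(x in F i) complex.Re (f x))
    (\sum_i \int[m]_(x in F i) complex.Im (f x)).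
  by elim/big_rec3: _ => //= i x y z _ ->.
by rewrite /cintegral !Rintegral_bigcup_fin.
Qed.

(** Pairing with a square integrable function is continuous for L2 convergence,
    because Young's inequality bounds the difference of the integrals by
    c^-1 |f_n - f|^2 + c |g|^2 for every c > 0.  The limit is stated for the two
    parts, so that only limits of real sequences are needed. *)
Lemma pairing_limit D (f_ : nat -> T -> R[i]) f g : measurable D ->
  (\forall n \near \oo, sq_integrable D (f_ n)) ->
  sq_integrable D f -> sq_integrable D g ->
  (fun n => \int[m]_(x in D) sqn (f_ n x - f x)) @ \oo --> (0 : R) ->
  (fun n => complex.Re (cintegral m D (fun x => f_ n x * g x))) @ \oo -->
    complex.Re (cintegral m D (fun x => f x * g x)) /\
  (fun n => complex.Im (cintegral m D (fun x => f_ n x * g x))) @ \oo -->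
    complex.Im (cintegral m D (fun x => f x * g x)).
Proof.
move=> mD f_i fi gi f_f.
pose K := \int[m]_(x in D) sqn (g x).
have K0 : 0 <= K by apply: Rintegral_ge0 => x _; exact: sqn_ge0.
have [mg ig] := gi.
have key (P : R[i] -> R) (Pm : forall z w e, 0 < e ->
      `|P (z * w)| <= e^-1 * sqn z + e * sqn w)
    (PB : forall z w, P (z - w) = P z - P w)
    (ci : forall h, cintegrable D h ->
      m.-integrable D (EFin \o (fun x => P (h x)))) :
  (fun n => \int[m]_(x in D) P (f_ n x * g x)) @ \oo -->
    \int[m]_(x in D) P (f x * g x).
  apply/cvgrPdist_lt => e e0.
  (* K may be 0, hence the shift by 1 in the weight. *)
  have K1 : 0 < K + 1 by rewrite ltr_pwDr.
  have [c c0 cK] : exists2 c, 0 < c & c * K <= e / 2.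
    exists (e / 2 / (K + 1)); first by rewrite !divr_gt0.
    rewrite mulrAC ler_pdivrMr// ler_wpM2l ?lerDl//.
    by rewrite divr_ge0// ltW.
  move/cvgrPdist_lt : f_f => /(_ (c * e / 2)).
  rewrite divr_gt0 ?mulr_gt0// => /(_ isT) f_f.
  near=> n.
  have f_ni : sq_integrable D (f_ n) by near: n.
  have /sq_integrableB/(_ fi) [//|md id] := f_ni.
  rewrite distrC -RintegralB//; try exact/ci/cintegrableM.
  have i1 : m.-integrable D (EFin \o (fun x => P ((f_ n x - f x) * g x))).
    by apply/ci/cintegrableM => //; exact: sq_integrableB.
  under eq_Rintegral do rewrite -PB -mulrBl.
  rewrite (le_lt_trans (le_normr_Rintegral mD i1))//.
  apply: (@le_lt_trans _ _ (\int[m]_(x in D)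
      (c^-1 * sqn (f_ n x - f x) + c * sqn (g x)))).
    apply: le_Rintegral => //.
    - exact: (integrable_norm i1).
    - exact: (integrableD mD (rintegrableZ _ mD id) (rintegrableZ _ mD ig)).
    - by move=> x _; exact: Pm.
  rewrite RintegralD//; try exact: rintegrableZ.
  rewrite !RintegralZl// -/K.
  suff : c^-1 * \int[m]_(x in D) sqn (f_ n x - f x) < e / 2 by lra.
  rewrite ltr_pdivrMl// mulrA.
  have : `|0 - \int[m]_(x in D) sqn (f_ n x - f x)| < c * e / 2 by near: n.
  by apply: le_lt_trans; rewrite sub0r normrN ler_norm.
split; [apply: key|apply: key].
- exact: Re_mul_le.
- by move=> z w; rewrite cReD cReN.
- by move=> h [].
- exact: Im_mul_le.
- by move=> z w; rewrite cImD cImN.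
- by move=> h [].
Unshelve. all: by end_near. Qed.

End ComplexIntegral.

(** * Measure preserving maps *)
Section MeasurePreserving.
Context {R : realType} {d : measure_display} {T : measurableType d}.
Variables (m : {measure set T -> \bar R}) (t : T -> T).
Hypothesis mt : measurable_fun setT t.
Hypothesis tm : forall A, measurable A -> m (t @^-1` A) = m A.

Lemma measurable_preimage A : measurable A -> measurable (t @^-1` A).
Proof. by move=> mA; rewrite -[X in measurable X]setTI; exact: mt. Qed.

Lemma integral_preserving_ge0 D (f : T -> \bar R) : measurable D ->
  measurable_fun D f -> (forall x, D x -> 0 <= f x)%E ->
  (\int[m]_(x in t @^-1` D) f (t x) = \int[m]_(x in D) f x)%E.
Proof.
move=> mD mf f0.
rewrite -(@ge0_integral_pushforward _ _ _ _ _ _ mt m D f mD mf); last first.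
  by move=> x /set_mem; exact: f0.
by apply: eq_measure_integral => A mA _; exact: tm.
Qed.

Lemma integrable_preserving D (f : T -> R) : measurable D ->
  m.-integrable D (EFin \o f) ->
  m.-integrable (t @^-1` D) (EFin \o (fun x => f (t x))).
Proof.
move=> mD /integrableP[mf fi].
have mtD := measurable_preimage mD.
apply/integrableP; split.
  apply/measurable_EFinP; move/measurable_EFinP : mf => mf.
  apply: (measurable_comp mD) => //; last exact: measurable_funTS.
  by move=> _ [x ? <-].
rewrite (@integral_preserving_ge0 _ (fun y => `|(f y)%:E|)%E)//.
exact: measurableT_comp.
Qed.

Lemma Rintegral_preserving D (f : T -> R) : measurable D ->
  m.-integrable D (EFin \o f) ->
  \int[m]_(x in t @^-1` D) f (t x) = \int[m]_(x in D) f x.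
Proof.
move=> mD fi; have mf := measurable_int _ fi.
rewrite /Rintegral; congr fine; rewrite integralE [RHS]integralE.
congr (_ - _)%E.
  have := @integral_preserving_ge0 D ((EFin \o f)^\+)%E mD (measurable_funepos mf).
  by move=> <- => [|x _]; [congr integral; exact: funepos_comp|exact: funepos_ge0].
have := @integral_preserving_ge0 D ((EFin \o f)^\-)%E mD (measurable_funeneg mf).
by move=> <- => [|x _]; [congr integral; exact: funeneg_comp|exact: funeneg_ge0].
Qed.

Lemma cmeasurable_preserving D (f : T -> R[i]) : measurable D ->
  cmeasurable D f -> cmeasurable (t @^-1` D) (fun x => f (t x)).
Proof.
move=> mD [f1 f2]; split.
  apply: (measurable_comp mD (f := fun y => complex.Re (f y)))=> //.
    by move=> _ [x ? <-].
  exact: measurable_funTS.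
apply: (measurable_comp mD (f := fun y => complex.Im (f y)))=> //.
  by move=> _ [x ? <-].
exact: measurable_funTS.
Qed.

Lemma sq_integrable_preserving D (f : T -> R[i]) : measurable D ->
  sq_integrable m D f -> sq_integrable m (t @^-1` D) (fun x => f (t x)).
Proof.
by move=> mD [f1 f2]; split; [exact: cmeasurable_preserving|exact: integrable_preserving f2].
Qed.

Lemma cintegral_preserving D (f : T -> R[i]) : measurable D ->
  cintegrable m D f ->
  cintegral m (t @^-1` D) (fun x => f (t x)) = cintegral m D f.
Proof.
move=> mD [f1 f2]; rewrite /cintegral.
by rewrite (Rintegral_preserving mD f1) (Rintegral_preserving mD f2).
Qed.

Lemma ae_preserving (P : T -> Prop) :
  {ae m, forall x, P x} -> {ae m, forall x, P (t x)}.
Proof.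
move=> [N [mN N0 PN]]; exists (t @^-1` N); split.
- exact: measurable_preimage.
- by rewrite tm.
- by move=> x; exact: PN.
Qed.

End MeasurePreserving.

(** * Balls of the Vilenkin group *)
Section Balls.
Context {p : nat}.
Implicit Types (x y z u : vilenkin p) (k n : int).

Lemma vilenkinP x y : (forall k, x k = y k) -> x = y.
Proof. by move=> xy; apply/val_inj/funext. Qed.

Lemma vilenkinD x y k : (x + y) k = x k + y k.
Proof. by []. Qed.

Lemma vilenkinN x k : (- x) k = - x k.
Proof. by []. Qed.

Definition vball z k : set (vilenkin p) := [set x | forall i, i < k -> x i = z i].

Lemma vball_center z k : vball z k z. Proof. by []. Qed.

Lemma vballP z k x : vball z k x <-> vG k (x - z).
Proof.
split=> h i ik; first by rewrite vilenkinD vilenkinN h// subrr.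
by have := h i ik; rewrite vilenkinD vilenkinN => /eqP; rewrite subr_eq0 => /eqP.
Qed.

Lemma vballE z k : vball z k = [set z + x | x in vG k].
Proof.
apply/seteqP; split=> [x /vballP xz|_ [x xk <-]].
  by exists (x - z) => //; rewrite addrC subrK.
by move=> i ik; rewrite vilenkinD xk// addr0.
Qed.

Lemma vball0 k : vball 0 k = vG k. Proof. by []. Qed.

Lemma vball_le z k n : k <= n -> vball z n `<=` vball z k.
Proof. by move=> kn x xz i ik; apply: xz; exact: lt_le_trans kn. Qed.

Lemma vball_eq z k y : vball z k y -> vball y k = vball z k.
Proof.
move=> zy; apply/seteqP; split=> x h i ik; first by rewrite h// zy.
by rewrite h// zy.
Qed.

Lemma vball_shift z k u x : vball z k (x - u) <-> vball (z + u) k x.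
Proof.
split=> h i ik; have := h i ik; rewrite !vilenkinD ?vilenkinN.
  by move=> <-; rewrite subrK.
by move=> ->; rewrite addrK.
Qed.

Lemma vball_nbhs z k : nbhs z (vball z k).
Proof. by exists k => // _ [x xk <-] i ik; rewrite vilenkinD xk// addr0. Qed.

Lemma open_vball z k : open (vball z k).
Proof.
rewrite openE => x /vball_eq <-; exact: vball_nbhs.
Qed.

Lemma nbhs_vball (O : set (vilenkin p)) x : nbhs x O ->
  exists k, vball x k `<=` O.
Proof. by case=> k _ kO; exists k; rewrite vballE. Qed.

Lemma measurable_vball z k : measurable (vball z k : set (borel (vilenkin p))).
Proof. by apply: sub_sigma_algebra; exact: open_vball. Qed.

(** The finitely many negative positions of nonzero digits are bounded below by
    minus the sum of their absolute values. *)
Lemma vG_exhaust x : exists n : nat, vG (- n%:Z) x.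
Proof.
case: x => f fP; have := fP; rewrite unfold_in => /asboolP /finite_seqP[s sE].
exists (\sum_(k <- s) `|k|%N)%N => k /= kn; apply/eqP; apply/negP => /negP fk.
have : [set k0 | k0 < 0 /\ f k0 != 0] k by split=> //; lia.
rewrite sE /= => ks; have : (`|k| <= \sum_(k <- s) `|k|)%N.
  by rewrite (big_rem k)//= leq_addr.
by move: kn; set S := (\sum_(_ <- _) _)%N; lia.
Qed.

(** Digits [t] in the positions n, ..., n + d - 1 and zeros elsewhere: these
    elements represent the cosets of G_(n + d) in G_n. *)
Definition vdigits_fun n d (t : {ffun 'I_d -> 'F_p}) : int -> 'F_p :=
  fun k => if k - n is Posz i then oapp t 0 (insub i) else 0.

Lemma vdigits_subproof n d (t : {ffun 'I_d -> 'F_p}) :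
  vdigits_fun n t \in @vilenkin_pred p.
Proof.
rewrite unfold_in; apply/asboolP.
apply: (@sub_finite_set _ _ [set n + (i : nat)%:Z | i in [set: 'I_d]]); last first.
  exact/finite_image/finite_finset.
move=> k [_]; rewrite /vdigits_fun; case E : (k - n) => [i|i]; last by rewrite eqxx.
case: insubP => [j jd ji|]; last by rewrite eqxx.
by move=> _; exists j => //=; rewrite ji -E addrC subrK.
Qed.

Definition vdigits n d (t : {ffun 'I_d -> 'F_p}) : vilenkin p :=
  Vilenkin (vdigits_subproof n t).

Lemma vdigitsE n d (t : {ffun 'I_d -> 'F_p}) (j : 'I_d) :
  vdigits n t (n + (j : nat)%:Z) = t j.
Proof.
rewrite /= /vdigits_fun addrC addKr; case: insubP => [i _ /val_inj ->//|].
by rewrite ltn_ord.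
Qed.

Lemma vdigits_vG n d (t : {ffun 'I_d -> 'F_p}) : vG n (vdigits n t).
Proof.
by move=> k kn; rewrite /= /vdigits_fun; case E : (k - n) => [i|i]//; lia.
Qed.

Lemma vG_bigcup n d : @vG p n =
  \bigcup_(t : {ffun 'I_d -> 'F_p}) vball (vdigits n t) (n + d%:Z).
Proof.
apply/seteqP; split=> [x xn|x [t _ xt] k kn].
  exists [ffun j : 'I_d => x (n + (j : nat)%:Z)] => // k kd.
  have [kn|kn] := ltP k n; first by rewrite xn// vdigits_vG.
  have jd : (`|k - n| < d)%N by lia.
  have -> : k = n + (Ordinal jd : nat)%:Z by rewrite /=; lia.
  by rewrite vdigitsE ffunE.
by rewrite xt ?vdigits_vG//; apply: (lt_le_trans kn); rewrite lerDl.
Qed.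

Lemma vG_trivIset n d : trivIset setT
  (fun t : {ffun 'I_d -> 'F_p} => vball (vdigits n t) (n + d%:Z)).
Proof.
move=> s t _ _ [x [xs xt]]; apply/ffunP => j.
rewrite -(vdigitsE n s) -(vdigitsE n t) -xs ?xt//; rewrite ltrD2l ltz_nat//.
Qed.

(** An open set is the union, over n and d, of those cosets of G_(d - n) in
    G_(-n) that it contains, and for given n and d there are finitely many of
    them.  The empty set is added to the balls to make them stable under
    intersection. *)
Lemma borel_vball : @measurable _ (borel (vilenkin p)) =
  <<s [set A | A = set0 \/ exists z k, A = vball z k] >>.
Proof.
apply/seteqP; split; last first.
  apply: smallest_sub; first exact: smallest_sigma_algebra.
  by move=> _ [->|[z [k ->]]]; [exact: measurable0|exact: measurable_vball].
apply: smallest_sub; first exact: smallest_sigma_algebra.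
set G := [set A | _].
move=> O oO; pose part n d (t : {ffun 'I_d -> 'F_p}) :=
  if `[< vball (vdigits n t) (n + d%:Z) `<=` O >]
  then vball (vdigits n t) (n + d%:Z) else set0.
have -> : O = \bigcup_(n in [set: nat]) \bigcup_(d in [set: nat])
    \big[setU/set0]_(t <- index_enum {ffun 'I_d -> 'F_p}) part (- n%:Z) d t.
  apply/seteqP; split=> x; last first.
    move=> [n _ [d _]]; rewrite -bigcup_seq => -[t _]; rewrite /part.
    by case: asboolP => // + xt; exact.
  move=> Ox; have [n xn] := vG_exhaust x.
  have /nbhs_vball[k kO] : nbhs x O by exact: open_nbhs_nbhs.
  exists n => //; exists (absz (k + n%:Z)) => //; rewrite -bigcup_seq.
  move: xn; rewrite (vG_bigcup (- n%:Z) (absz (k + n%:Z))) => -[t _ xt].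
  exists t; first by rewrite /= mem_index_enum.
  rewrite /part asboolT//; rewrite -(vball_eq xt).
  by apply: subset_trans kO; apply: vball_le; lia.
have GP A : G A -> @measurable _ (g_sigma_algebraType G) A.
  exact: sub_sigma_algebra.
apply: (@bigcupT_measurable _ (g_sigma_algebraType G)) => n.
apply: (@bigcupT_measurable _ (g_sigma_algebraType G)) => d.
apply: (@bigsetU_measurable _ (g_sigma_algebraType G)) => t _.
by apply: GP; rewrite /part; case: ifP => _; [right; do 2 eexists|left].
Qed.

End Balls.

(** * Translations and evaluations are measurable *)

Lemma measurable_fun_borel (S T : ptopologicalType) (f : S -> T) :
  continuous f ->
  measurable_fun setT (f : borel S -> borel T).
Proof.
move=> /continuousP cf; apply: (@measurability _ _ (borel S) (borel T) _ _ open) => //.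
move=> _ [U oU <-].
by rewrite setTI; apply: sub_sigma_algebra; exact: cf.
Qed.

Lemma measurable_fun_borelR (R : realType) (S : ptopologicalType) (f : S -> R) :
  continuous f -> measurable_fun setT (f : borel S -> R).
Proof.
move=> /continuousP cf; apply: (measurability (@RGenOInfty.G R)).
  exact: RGenOInfty.measurableE.
move=> _ [_ [x ->] <-]; rewrite setTI; apply: sub_sigma_algebra.
by apply: cf; exact: rray_open.
Qed.

Section HaarVilenkin.
Context {R : realType} {p : nat}.
Variable mu : {measure set (borel (vilenkin p)) -> \bar R}.
Hypothesis mu_haar : haarG mu.

Lemma vtranslation_measurable (h : vilenkin p) :
  measurable_fun setT (fun x : borel (vilenkin p) => x - h : borel (vilenkin p)).
Proof.
apply: (@measurable_fun_borel (vilenkin p) (vilenkin p) (fun x => x - h)).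
move=> x A [k _ kA]; exists k => // _ [y yk <-] /=; apply: kA.
by exists y => //; rewrite addrAC.
Qed.

Lemma vtranslation_haar (h : vilenkin p) (A : set (borel (vilenkin p))) :
  measurable A -> mu ((fun x => x - h) @^-1` A) = mu A.
Proof.
move=> mA; rewrite -(mu_haar.1 h A mA); congr (mu _).
apply/seteqP; split=> [x /= xA|_ [x xA <-] /=].
  by exists (x - h) => //; rewrite addrC subrK.
by rewrite addrAC subrr add0r.
Qed.

Lemma mu_vball (z : vilenkin p) k : mu (vball z k) = ((p%:R : R) ^ (- k))%:E.
Proof.
by rewrite vballE mu_haar.1 ?mu_haar.2// -vball0; exact: measurable_vball.
Qed.

Lemma mu_vball_lty (z : vilenkin p) k : (mu (vball z k) < +oo)%E.
Proof. by rewrite mu_vball ltry. Qed.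

End HaarVilenkin.

Section CharacterTopology.
Context {R : realType} {p : nat}.
Local Notation X := (character R p).
Implicit Types (chi psi z : X) (u x : vilenkin p).

Lemma char0 chi : chi 0 = 1.
Proof.
apply: (mulfI (chi_neq0 chi 0)); rewrite mulr1 -chi_add addr0//.
Qed.

Lemma charN chi x : chi (- x) = (chi x)^*.
Proof.
apply: (mulfI (chi_neq0 chi x)); rewrite -chi_add subrr char0.
by rewrite -normCK chi_norm expr1n.
Qed.

Lemma sqn_char chi x : sqn (chi x) = 1.
Proof. by apply: complexI; rewrite -sqn_norm chi_norm expr1n. Qed.

Lemma annihilator_vball k chi (y x : vilenkin p) :
  annihilator R p k chi -> vball y k x -> chi x = chi y.
Proof. by move=> chik /vballP/chik h; rewrite -(subrK y x) chi_add h mul1r. Qed.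

Lemma eval_char_continuous u : continuous (fun chi : X => chi u : R[i]^o).
Proof.
apply/continuousP => O oO.
exists [set g | [set g x | x in [set u]] `<=` O].
  by apply: compact_open_open => //; exact: compact_set1.
by apply/seteqP; split=> chi /= h; [apply: h; exists u|move=> _ [_ -> <-]].
Qed.

(** In the uniform structure on a compact set, multiplication by a unimodular
    function is an isometry. *)
Lemma chi_mul_continuous psi : continuous (fun chi : X => (psi * chi)%g : X).
Proof.
apply: (@continuous_comp_initial X X {compact-open, vilenkin p -> R[i]^o}
  (@chi_fun R p)) => chi.
have FF : Filter (nbhs (chi : X)) by exact: nbhs_filter.
have conv : {family compact, (@chi_fun R p : X -> vilenkin p -> R[i]^o) @ chi -->
    (chi : vilenkin p -> R[i]^o)}.
  apply/(compact_open_fam_compactP (@chi_continuous R p chi)).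
  exact: (@initial_continuous X {compact-open, vilenkin p -> R[i]^o} (@chi_fun R p)).
apply/(compact_open_fam_compactP (@chi_continuous R p (psi * chi)%g)).
apply/fam_cvgP => K cK; move/fam_cvgP : conv => /(_ K cK) conv.
move=> P /uniform_nbhs[E [entE EP]].
apply: (filterS EP) => {P EP}.
move: entE; rewrite -entourage_ballE => -[e /= e0 eE].
have /conv : nbhs (chi : {uniform` K -> R[i]^o})
    [set h | forall y, K y -> ball (chi y : R[i]^o) e (h y)].
  apply/uniform_nbhs; exists [set xy | ball (xy.1 : R[i]^o) e xy.2]; split => //.
  by rewrite -entourage_ballE; exists e.
apply: (@filterS X (nbhs chi) FF) => h hK y Ky; apply: eE => /=.
have := hK y Ky; rewrite -ball_normE /ball_ /=.
by rewrite -mulrBr normrM chi_norm mul1r.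
Qed.

Lemma Re_continuous : continuous (fun z : R[i]^o => complex.Re z : R).
Proof.
move=> z A /nbhs_ballP[e /= e0 eA].
apply/nbhs_ballP; exists (e%:C)%C => /=; first by rewrite ltcR.
move=> w; rewrite -ball_normE /ball_ /= => zw.
apply: eA; rewrite -ball_normE /ball_ /=.
rewrite -ltcR; apply: le_lt_trans zw; rewrite -cReN -cReD.
exact: normc_ge_Re.
Qed.

Lemma Im_continuous : continuous (fun z : R[i]^o => complex.Im z : R).
Proof.
move=> z A /nbhs_ballP[e /= e0 eA].
apply/nbhs_ballP; exists (e%:C)%C => /=; first by rewrite ltcR.
move=> w; rewrite -ball_normE /ball_ /= => zw.
apply: eA; rewrite -ball_normE /ball_ /=.
rewrite -ltcR; apply: le_lt_trans zw; rewrite -cImN -cImD.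
exact: normc_ge_Im.
Qed.

Lemma eval_char_cmeasurable u (A : set (borel X)) : measurable A ->
  @cmeasurable R _ (borel X) A (fun chi => chi u).
Proof.
move=> mA; split; apply: (measurable_funS measurableT) => //.
  apply: (measurable_fun_borelR (f := fun chi : X => complex.Re (chi u))) => chi.
  exact: (@continuous_comp X R[i]^o R (fun chi => chi u) (@complex.Re R) chi
    (@eval_char_continuous u chi) (@Re_continuous _)).
apply: (measurable_fun_borelR (f := fun chi : X => complex.Im (chi u))) => chi.
exact: (@continuous_comp X R[i]^o R (fun chi => chi u) (@complex.Im R) chi
    (@eval_char_continuous u chi) (@Im_continuous _)).
Qed.

(** The coset of [z] modulo the annihilator of G_k, described by the values of
    its elements: in this form it is visibly closed. *)
Definition char_coset k z : set X := [set chi | forall x, vG k x -> chi x = z x].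

Lemma char_coset1 k : char_coset k 1%g = annihilator R p k.
Proof. by []. Qed.

Lemma coset_charE k z : coset_char (annihilator R p k) z = char_coset k z.
Proof.
apply/seteqP; split=> [_ [chi chik <-] x xk|chi h].
  by rewrite /= chik// mul1r.
exists (chi * z^-1)%g; last by rewrite -mulgA mulVg mulg1.
by move=> x xk; rewrite /= h// mulfV// chi_neq0.
Qed.

Lemma measurable_char_coset k z : measurable (char_coset k z : set (borel X)).
Proof.
rewrite -[X in measurable X]setCK; apply: measurableC; apply: sub_sigma_algebra.
have -> : ~` char_coset k z = \bigcup_(x in vG k) [set chi : X | chi x != z x].
  apply/seteqP; split=> chi.
    by move=> /existsNP[x /not_implyP[xk /eqP chix]]; exists x.
  by move=> [x xk /= /eqP chix] /(_ x xk).
apply: bigcup_open => x _.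
have /continuousP/(_ (~` [set (z x : R[i]^o)])) := @eval_char_continuous x.
rewrite (_ : _ @^-1` _ = [set chi : X | chi x != z x]); first apply.
  by apply: closed_openC; exact: (accessible_closed_set1 (hausdorff_accessible (@norm_hausdorff _ _))).
by apply/seteqP; split=> chi /= /eqP.
Qed.

End CharacterTopology.

(** * Integrals of characters over cosets *)
Section RademacherValues.
Context {R : realType} {p : nat} (p_prime : prime p).

(** cos t = 1 - 2 sin(t/2)^2 and 0 < t/2 < pi. *)
Lemma expi_eq1 (t : R) : 0 < t < 2 * pi -> expi t != 1.
Proof.
move=> /andP[t0 t2]; apply/eqP => -[ct _].
have s0 : 0 < sin (t / 2) by apply: sin_gt0_pi; apply/andP; split; lra.
move: ct; have -> : t = t / 2 + t / 2 by lra.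
by rewrite cosD; have := cos2Dsin2 (t / 2); nra.
Qed.

Lemma rademacher_eq1 i (x : vilenkin p) :
  (rademacher R p_prime i x == 1) = (x i == 0).
Proof.
have p0 : (0 < p%:R :> R) by rewrite ltr0n prime_gt0.
apply/idP/idP => [|/eqP x0]; last first.
  by rewrite /= /rademacher_fun x0 /= mulr0 mul0r /expi cos0 sin0.
apply: contraLR => xi; apply: expi_eq1.
have x0 : (0 < x i)%N by rewrite lt0n.
have xp : (x i < p)%N by apply: leq_trans (ltn_ord (x i)) _; rewrite Fp_cast.
have pi2 : 0 < 2 * pi :> R by rewrite mulr_gt0 ?pi_gt0.
apply/andP; split; first by rewrite divr_gt0// mulr_gt0// ltr0n.
by rewrite ltr_pdivrMr// ltr_pM2l// ltr_nat.
Qed.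

Lemma rademacher_annihilator i k : i < k ->
  annihilator R p k (rademacher R p_prime i).
Proof. by move=> ik x xk; apply/eqP; rewrite rademacher_eq1 xk. Qed.

Lemma annihilator_separates k (u : vilenkin p) : ~ vG k u ->
  exists2 psi, annihilator R p k psi & psi u != 1.
Proof.
move=> /existsNP[i /not_implyP[ik /eqP ui]].
exists (rademacher R p_prime i); first exact: rademacher_annihilator.
by rewrite rademacher_eq1.
Qed.

End RademacherValues.

Section HaarCharacters.
Context {R : realType} {p : nat}.
Local Notation X := (character R p).
Variable nu : {measure set (borel X) -> \bar R}.
Hypothesis nu_haar : haarX nu.
Implicit Types (chi psi z : X) (u x : vilenkin p).

Lemma ctranslation_measurable psi :
  measurable_fun setT (fun chi : borel X => (psi * chi)%g : borel X).
Proof. exact: (measurable_fun_borel (@chi_mul_continuous R p psi)). Qed.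

Lemma ctranslation_haar psi (A : set (borel X)) : measurable A ->
  nu ((fun chi => (psi * chi)%g) @^-1` A) = nu A.
Proof.
move=> mA; rewrite -(nu_haar.1 (psi^-1)%g A mA); congr (nu _).
apply/seteqP; split=> [chi /= xA|_ [chi xA <-] /=].
  by exists (psi * chi)%g => //; rewrite mulgA mulVg mul1g.
by rewrite mulgA mulgV mul1g.
Qed.

Lemma nu_char_coset k z : nu (char_coset k z) = ((p%:R : R) ^ k)%:E.
Proof.
rewrite -nu_haar.2 -(nu_haar.1 z (annihilator R p k)) -?char_coset1; last first.
  exact: measurable_char_coset.
congr (nu _); apply/seteqP; split=> [chi h|_ [chi h <-] x xk].
  exists (z^-1 * chi)%g; last by rewrite mulgA mulgV mul1g.
  by move=> x xk /=; rewrite h// mulVf// chi_neq0.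
by rewrite /= h// mulr1.
Qed.

Lemma nu_char_coset_lty k z : (nu (char_coset k z) < +oo)%E.
Proof. by rewrite nu_char_coset ltry. Qed.

Lemma measurable_ann k : measurable (annihilator R p k : set (borel X)).
Proof. by rewrite -char_coset1; exact: measurable_char_coset. Qed.

Lemma nu_ann_lty k : (nu (annihilator R p k) < +oo)%E.
Proof. by rewrite nu_haar.2 ltry. Qed.

Lemma sq_integrable_char (A : set (borel X)) u : measurable A ->
  (nu A < +oo)%E -> sq_integrable nu A (fun chi => chi u).
Proof.
move=> mA fA; apply: (@sq_integrable_bounded _ _ _ _ _ _ 1) => //.
  exact: eval_char_cmeasurable.
by move=> chi _; rewrite sqn_char.
Qed.

Lemma cintegrable_char (A : set (borel X)) u : measurable A ->
  (nu A < +oo)%E -> cintegrable nu A (fun chi => chi u).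
Proof. by move=> mA fA; apply/sq_integrable_cintegrable/sq_integrable_char. Qed.

(** Translation by [psi] leaves the integral unchanged and multiplies it by
    [psi u]. *)
Lemma cintegral_char_invariant (A : set (borel X)) psi u : measurable A ->
  (nu A < +oo)%E -> (fun chi => (psi * chi)%g) @^-1` A = A -> psi u != 1 ->
  cintegral nu A (fun chi => chi u) = 0.
Proof.
move=> mA fA psiA psiu.
have iA := cintegrable_char u mA fA.
have := cintegral_preserving (ctranslation_measurable psi)
  (@ctranslation_haar psi) mA iA.
rewrite psiA /= cintegralZ// => /eqP.
rewrite -subr_eq0 -[X in _ - X]mul1r -mulrBl mulf_eq0 subr_eq0 (negbTE psiu) /=.
by move/eqP.
Qed.

(** Orthogonality: either [chi u] is constant on the coset, or a Rademacher
    character in the annihilator of G_k differs from 1 at [u]. *)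
Lemma cintegral_char_coset (p_prime : prime p) k z u :
  cintegral nu (char_coset k z) (fun chi => chi u) =
  if `[< vG k u >] then z u * ((p%:R ^ k : R)%:C)%C else 0.
Proof.
have mA := measurable_char_coset k z.
case: asboolP => ku.
  rewrite (@eq_cintegral _ _ _ nu _ _ (fun=> z u)); last by move=> chi; exact.
  by rewrite cintegral_cst// nu_char_coset.
have [psi psik psiu] := annihilator_separates (R := R) p_prime ku.
apply: (cintegral_char_invariant mA (nu_char_coset_lty k z) _ psiu).
by apply/seteqP; split=> chi h x xk; have := h x xk; rewrite /= psik// mul1r.
Qed.

Lemma vH0_elementary_eta (p_prime : prime p) M (b : 'I_M -> 'I_p) u : vH0 p u ->
  elementary_eta R p_prime b u = 1.
Proof.
move=> u0; rewrite /elementary_eta.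
have ev (s : seq 'I_M) (F : 'I_M -> X) : (forall i, F i u = 1) ->
    (\prod_(i <- s) F i)%g u = 1.
  by move=> F1; elim: s => [|i s IH]; rewrite ?big_nil ?big_cons//= F1 IH mulr1.
apply: ev => i; elim: (b i : nat) => [|n IH]; first by rewrite expg0.
rewrite expgS /= -[X in _ * X = _]/((rademacher R p_prime i ^+ n)%g u) IH mulr1.
by apply/eqP; rewrite (rademacher_eq1 p_prime); apply/eqP; apply: u0.
Qed.

Lemma elementary_measurable (p_prime : prime p) N M (E : set X) :
  elementary p_prime N M E -> measurable (E : set (borel X)).
Proof.
move=> [a [b [_ [_ <-] _ _ _]]]; apply: fin_bigcup_measurable => //.
by move=> j _; rewrite coset_charE; exact: measurable_char_coset.
Qed.

(** On H_0 the factors eta_j are 1, so that E contributes as much as the union of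
    the cosets of the xi_j, which is the annihilator of G_0. *)
Lemma cintegral_char_elementary (p_prime : prime p) N M (E : set X) u :
  E `<=` annihilator R p M%:Z -> elementary p_prime N M E -> vH0 p u ->
  cintegral nu E (fun chi => chi u) = (u == 0)%:R.
Proof.
move=> EM elE u0; have mE := elementary_measurable elE.
have iann k := cintegrable_char u (measurable_ann k) (nu_ann_lty k).
have iE := cintegrableS (measurable_ann _) mE EM (iann _).
case: elE => [a [b [_ [tE UE] [t0 U0] _ _]]].
have mC z : measurable (coset_char (annihilator R p (- N%:Z)) z : set (borel X)).
  by rewrite coset_charE; exact: measurable_char_coset.
have -> : (u == 0)%:R = cintegral nu (annihilator R p 0) (fun chi => chi u).
  rewrite -char_coset1 (cintegral_char_coset p_prime) expr0z mulr1.
  case: asboolP => ku; last first.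
    by case: eqP => // u0'; case: ku; rewrite u0'.
  rewrite (_ : u = 0) ?eqxx//; apply: vilenkinP => k.
  by have [k0|k0] := leP 0 k; [exact: u0|exact: ku].
rewrite -U0 -UE !cintegral_bigcup_fin//.
- apply: eq_bigr => j _; rewrite !coset_charE !(cintegral_char_coset p_prime).
  by rewrite /= vH0_elementary_eta// mulr1.
- by rewrite U0; exact: iann.
- by rewrite UE.
Qed.

End HaarCharacters.

(** * Changing the domain of an integral *)
Section IntegralDomains.
Context {R : realType} {d : measure_display} {T : measurableType d}.
Variable m : {measure set T -> \bar R}.

Lemma memL2_sq_integrable (f : T -> R[i]) : memL2 m f -> sq_integrable m setT f.
Proof.
move=> [f1 f2 f3]; split; first by split.
apply/integrableP; split.
  by apply/measurable_EFinP; exact: measurable_sqn.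
by under eq_integral do rewrite /= ger0_norm ?sqn_ge0// -sqnE.
Qed.

Lemma sq_integrable_memL2 (f : T -> R[i]) : sq_integrable m setT f -> memL2 m f.
Proof.
move=> [[f1 f2] /integrableP[_ f3]]; split => //.
by under eq_integral do rewrite sqnE -[sqn _]ger0_norm ?sqn_ge0//.
Qed.

Lemma ae_impl (P Q : T -> Prop) : (forall x, P x -> Q x) ->
  {ae m, forall x, P x} -> {ae m, forall x, Q x}.
Proof. by move=> PQ; apply: filterS. Qed.

Lemma ae_impl2 (P P' Q : T -> Prop) : (forall x, P x -> P' x -> Q x) ->
  {ae m, forall x, P x} -> {ae m, forall x, P' x} -> {ae m, forall x, Q x}.
Proof. by move=> PQ; apply: filterS2. Qed.

(** A simple function below the restriction of [f] is also below [f].  This is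
    applied to |F_n - phihat|^2 over the whole dual group, where F_n is a finite
    sum on each annihilator only. *)
Lemma ge0_integral_subset_le D (f : T -> \bar R) : (forall x, 0 <= f x)%E ->
  (\int[m]_(x in D) f x <= \int[m]_x f x)%E.
Proof.
move=> f0; rewrite ge0_integralE// ge0_integralTE//.
apply: le_ereal_sup => _ [h hf <-]; exists h => // x.
apply: le_trans (hf x) _; rewrite patchE; case: ifP => // _; exact: f0.
Qed.

Lemma cintegral_support D D' (f : T -> R[i]) : measurable D -> measurable D' ->
  D' `<=` D -> cintegrable m D f ->
  {ae m, forall x, D x -> ~ D' x -> f x = 0} ->
  cintegral m D f = cintegral m D' f.
Proof.
move=> mD mD' sD [f1 f2] f0.
have mDD : measurable (D `\` D') by exact: measurableD.
have key (P : R[i] -> R) : P 0 = 0 -> m.-integrable D (EFin \o (fun x => P (f x))) ->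
    \int[m]_(x in D) P (f x) = \int[m]_(x in D') P (f x).
  move=> P0 Pi; rewrite -{1}(setDUK sD) Rintegral_setU//; last 2 first.
  - by rewrite setDUK.
  - by rewrite disj_set2E setDIK.
  rewrite -[RHS]addr0; congr (_ + _); rewrite /Rintegral.
  rewrite (ae_eq_integral (cst 0%E)) ?integral0//.
    by apply: measurable_funS (measurable_int _ Pi) => // x [].
  by apply: filterS f0 => x h [Dx D'x] /=; rewrite h ?P0.
by rewrite /cintegral (key (@complex.Re R))// (key (@complex.Im R)).
Qed.

Lemma Rintegral_exhaust (F : nat -> set T) (h : T -> R) :
  (forall n, measurable (F n)) -> (forall x, \forall n \near \oo, F n x) ->
  m.-integrable setT (EFin \o h) ->
  (fun n => \int[m]_(x in F n) h x) @ \oo --> \int[m]_x h x.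
Proof.
move=> mF FT ih; have mh := measurable_int _ ih.
have [] := @dominated_convergence _ _ _ m setT measurableT
  (fun n => (EFin \o h) \_ (F n)) (EFin \o h) (fun x => `|(h x)%:E|%E).
- move=> n; apply/measurable_restrict => //.
  by apply: measurable_funS mh.
- exact: mh.
- apply: aeW => x _; apply: cvg_near_cst.
  by apply: filterS (FT x) => n Fn; rewrite patchE mem_set.
- exact: integrable_abse ih.
- apply: aeW => x n _; rewrite patchE; case: ifP => _ //.
  by rewrite abse0 abse_ge0.
move=> _ _ /=; under eq_fun do rewrite -integral_mkcond.
rewrite -[X in _ --> X -> _]fineK; last exact: integrable_fin_num.
by move/fine_cvg.
Qed.

Lemma cintegral_exhaust (F : nat -> set T) (f : T -> R[i]) :
  (forall n, measurable (F n)) -> (forall x, \forall n \near \oo, F n x) ->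
  cintegrable m setT f ->
  (fun n => complex.Re (cintegral m (F n) f)) @ \oo -->
    complex.Re (cintegral m setT f) /\
  (fun n => complex.Im (cintegral m (F n) f)) @ \oo -->
    complex.Im (cintegral m setT f).
Proof. by move=> mF FT [f1 f2]; split; exact: Rintegral_exhaust. Qed.

End IntegralDomains.

(** * A function is determined by its integrals over balls *)
Section BallUniqueness.
Context {R : realType} {p : nat}.
Variable mu : {measure set (borel (vilenkin p)) -> \bar R}.
Implicit Types (y z : vilenkin p) (k M : int).

Lemma vball_setI z z' k k' x : vball z k x -> vball z' k' x ->
  vball z k `&` vball z' k' = vball x (Num.max k k').
Proof.
move=> zx zx'; rewrite -(vball_eq zx) -(vball_eq zx'); apply/seteqP; split=> w.
  by move=> [h h'] i; rewrite lt_max => /orP[]; [exact: h|exact: h'].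
by move=> h; split=> i ik; apply: h; rewrite lt_max ik ?orbT.
Qed.

Lemma vball_setI_closed :
  setI_closed [set A | A = set0 \/ exists z k, A = @vball p z k].
Proof.
move=> A B [->|[z [k ->]]]; first by left; rewrite set0I.
move=> [->|[z' [k' ->]]]; first by left; rewrite setI0.
have [[x [xz xz']]|nx] := pselect (exists x, (vball z k `&` vball z' k') x).
  by right; exists x, (Num.max k k'); exact: vball_setI.
by left; apply/seteqP; split=> // x xzz; apply: nx; exists x.
Qed.

(** The sets over whose intersection with the ball the integral vanishes form a
    Dynkin system containing all the balls, because two balls are nested or
    disjoint.  By the pi-lambda theorem it contains all Borel sets. *)
Lemma ae_eq0_vball y M (h : vilenkin p -> R) :
  mu.-integrable (vball y M) (EFin \o h : borel (vilenkin p) -> \bar R) ->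
  (forall z k, vball y M z -> M <= k ->
    \int[mu]_(x in vball z k) h x = 0) ->
  {ae mu, forall x, vball y M x -> h x = 0}.
Proof.
move=> ih h0; pose D : set (borel (vilenkin p)) := vball y M.
rewrite -/D in ih h0 *; have mD : measurable D by exact: measurable_vball.
have mI (A : set (borel (vilenkin p))) : measurable A -> measurable (D `&` A).
  by move=> mA; exact: measurableI.
have iI (A : set (borel (vilenkin p))) : measurable A ->
    mu.-integrable (D `&` A) (EFin \o h).
  by move=> mA; apply: integrableS ih => //; exact: mI.
have h0E z k : vball y M z -> M <= k -> (\int[mu]_(x in vball z k) (h x)%:E = 0)%E.
  move=> zy Mk; rewrite -[LHS]fineK; first by rewrite -/(Rintegral _ _ _) h0.
  apply: integrable_fin_num; first exact: measurable_vball.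
  apply: integrableS ih => //; first exact: measurable_vball.
  by rewrite /D -(vball_eq zy); exact: vball_le.
pose H := [set A : set (borel (vilenkin p)) | measurable A /\
  (\int[mu]_(x in D `&` A) (h x)%:E = 0)%E].
have dynH : dynkin H.
  split.
  - by split; [exact: measurableT|rewrite setIT; exact: h0E].
  - move=> A [mA A0]; split; first exact: measurableC.
    have D0 : (\int[mu]_(x in D) (h x)%:E = 0)%E.
      exact: h0E (@vball_center p y M) (lexx M).
    have eD : D = (D `&` A) `|` (D `&` ~` A) by rewrite -setIUr setUv setIT.
    have mDA : measurable (D `&` A) by exact: mI.
    have mDAC : measurable (D `&` ~` A) by apply: mI; exact: measurableC.
    have dis : [disjoint (D `&` A) & (D `&` ~` A)]%classic.
      by rewrite disj_set2E setIACA setICr setI0.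
    have mh : measurable_fun ((D `&` A) `|` (D `&` ~` A)) (EFin \o h).
      by rewrite -eD; exact: measurable_int ih.
    move: D0; rewrite {1}eD (integral_setU mu mDA mDAC mh dis).
    by rewrite A0 add0e.
  - move=> F tF HF; have mF i : measurable (F i) by case: (HF i).
    split; first exact: bigcupT_measurable.
    rewrite setI_bigcupr integral_bigcup.
    + by rewrite eseries0// => i _ _; case: (HF i).
    + by apply: trivIset_setIl.
    + by move=> k; exact: mI.
    + by rewrite -setI_bigcupr; apply: iI; exact: bigcupT_measurable.
have HM A : measurable A -> (\int[mu]_(x in D `&` A) (h x)%:E = 0)%E.
  rewrite borel_vball => mA; suff [] : H A by [].
  move: A mA; apply: (lambda_system_subset vball_setI_closed) => //.
    exact/dynkin_lambda_system.
  move=> _ [->|[z [k ->]]]; split; [exact: measurable0| |exact: measurable_vball|].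
    by rewrite setI0 integral_set0.
  have [[x [xz xz']]|nx] := pselect (exists x, (D `&` vball z k) x).
    by rewrite (vball_setI xz xz'); apply: h0E => //; rewrite le_max lexx.
  rewrite (_ : _ `&` _ = set0) ?integral_set0//.
  by apply/seteqP; split=> // x xzz; apply: nx; exists x.
have : ae_eq mu D (EFin \o h) (cst 0%E).
  apply: (integral_ae_eq mD ih (measurable_cst _)) => A AD mA.
  by rewrite integral0 -(setIidr AD) HM.
by apply: filterS => x hx Dx; case: (hx Dx).
Qed.

End BallUniqueness.

(** * Fourier inversion and Plancherel *)
Section Fourier.
Context {R : realType} {p : nat} (p_prime : prime p).
Local Notation G := (vilenkin p).
Local Notation X := (character R p).
Local Notation ann := (annihilator R p).
Variables (mu : {measure set (borel G) -> \bar R}) (mu_haar : haarG mu).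
Variables (nu : {measure set (borel X) -> \bar R}) (nu_haar : haarX nu).
Variables (phi : G -> R[i]) (phi_L2 : @sq_integrable R _ (borel G) mu setT phi).
Implicit Types (chi : X) (x y z u : G) (k : int).

Lemma char_cmeasurable chi : @cmeasurable R _ (borel G) setT (fun x => chi x).
Proof.
split.
  apply: (measurable_fun_borelR (f := fun x : G => complex.Re (chi x))) => x.
  exact: (@continuous_comp G R[i]^o R chi (@complex.Re R) x
    (@chi_continuous R p chi x) (@Re_continuous _ _)).
apply: (measurable_fun_borelR (f := fun x : G => complex.Im (chi x))) => x.
exact: (@continuous_comp G R[i]^o R chi (@complex.Im R) x
  (@chi_continuous R p chi x) (@Im_continuous _ _)).
Qed.

Lemma measurable_vG n : measurable (@vG p n : set (borel G)).
Proof. by rewrite -vball0; exact: measurable_vball. Qed.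

(** The transform of phi cut off to G_(-n), whose L2-limit is the Fourier
    transform of phi. *)
Definition partial_fourier (n : nat) chi : R[i] :=
  cintegral mu (vG (- n%:Z)) (fun x => phi x * (chi x)^*).

Definition ball_integral z k : R[i] := cintegral mu (vball z k) phi.

Lemma phi_vball z k : sq_integrable mu (vball z k) phi.
Proof. by apply: sq_integrableS phi_L2 => //; exact: measurable_vball. Qed.

Lemma cintegrable_phi_vball z k : cintegrable mu (vball z k) phi.
Proof.
apply: sq_integrable_cintegrable (phi_vball z k); first exact: measurable_vball.
exact: mu_vball_lty.
Qed.

(** A character of the annihilator of G_k is constant on each coset of G_k; here
    k = d - n. *)
Lemma partial_fourierE (n d : nat) chi : ann (- n%:Z + d%:Z) chi ->
  partial_fourier n chi = \sum_(t : {ffun 'I_d -> 'F_p})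
    (chi (vdigits (- n%:Z) t))^* * ball_integral (vdigits (- n%:Z) t) (- n%:Z + d%:Z).
Proof.
move=> chik; rewrite /partial_fourier (vG_bigcup (- n%:Z) d).
rewrite cintegral_bigcup_fin; last first.
- rewrite -vG_bigcup; apply: cintegrableM; first exact: measurable_vG.
    by rewrite -vball0; exact: phi_vball.
  apply: (@sq_integrable_bounded _ _ _ _ _ _ 1); first exact: measurable_vG.
  + by rewrite -vball0; exact: mu_vball_lty.
  + apply: cmeasurable_conj; apply: cmeasurableS (char_cmeasurable chi) => //.
  + by move=> x _; rewrite sqn_conj sqn_char.
- exact: vG_trivIset.
- by move=> t; exact: measurable_vball.
apply: eq_bigr => t _; rewrite /ball_integral -cintegralZ//.
- by apply: eq_cintegral => x xt; rewrite mulrC (annihilator_vball chik xt).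
- exact: measurable_vball.
- exact: cintegrable_phi_vball.
Qed.

Lemma int_offset n k : (- n%:Z <= k)%R -> exists d : nat, k = - n%:Z + d%:Z.
Proof. by move=> nk; exists (absz (k + n%:Z)); lia. Qed.

Lemma partial_fourier_sq_integrable n k : - n%:Z <= k ->
  sq_integrable nu (ann k) (partial_fourier n).
Proof.
move=> /int_offset[d ->].
pose f t chi := (chi (@vdigits p (- n%:Z) d t))^* *
  ball_integral (vdigits (- n%:Z) t) (- n%:Z + d%:Z).
apply: (@eq_sq_integrable _ _ (borel X) nu _ (fun chi => \sum_t f t chi)).
- exact: measurable_ann.
- by move=> chi /partial_fourierE ->.
- apply: sq_integrable_sum; [exact: measurable_ann|exact: nu_ann_lty|move=> t].
  rewrite /f; set c := ball_integral _ _.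
  apply: (@sq_integrableM_bounded _ _ (borel X) nu _ _ (fun=> c) (sqn c)) => //.
    exact: measurable_ann.
  apply/sq_integrable_conj/sq_integrable_char; first exact: measurable_ann.
  exact: nu_ann_lty.
Qed.

Lemma pairing_partial_fourier (n d : nat) k (g : X -> R[i]) :
  k = - n%:Z + d%:Z -> sq_integrable nu (ann k) g ->
  cintegral nu (ann k) (fun chi => partial_fourier n chi * g chi) =
  \sum_(t : {ffun 'I_d -> 'F_p}) ball_integral (vdigits (- n%:Z) t) k *
    cintegral nu (ann k) (fun chi => (chi (vdigits (- n%:Z) t))^* * g chi).
Proof.
move=> kE gi; have mA := @measurable_ann R p k; have fA := nu_ann_lty nu_haar k.
have ci t : cintegrable nu (ann k)
    (fun chi => (chi (@vdigits p (- n%:Z) d t))^* * g chi).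
  apply: cintegrableM => //; apply/sq_integrable_conj.
  exact: sq_integrable_char.
transitivity (cintegral nu (ann k) (fun chi => \sum_(t : {ffun 'I_d -> 'F_p})
    ball_integral (vdigits (- n%:Z) t) k *
      ((chi (vdigits (- n%:Z) t))^* * g chi))).
  apply: eq_cintegral => chi; rewrite {1}kE => /partial_fourierE ->.
  rewrite mulr_suml; apply: eq_bigr => t _; rewrite -kE.
  by rewrite mulrA [X in X * _]mulrC.
rewrite cintegral_sum//; last by move=> t; exact: cintegrableZ.
by apply: eq_bigr => t _; rewrite cintegralZ.
Qed.

Lemma ball_integral_eq z y k : vball z k y -> ball_integral y k = ball_integral z k.
Proof. by rewrite /ball_integral => /vball_eq ->. Qed.

(** By orthogonality only the coset that contains [z] contributes. *)
Lemma pairing_partial_fourier_char (n : nat) k z : - n%:Z <= k -> vG (- n%:Z) z ->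
  cintegral nu (ann k) (fun chi => partial_fourier n chi * chi z) =
  (p%:R ^ k : R)%:C%C * ball_integral z k.
Proof.
move=> /int_offset[d kE] zn.
rewrite (pairing_partial_fourier kE); last first.
  by apply: sq_integrable_char; [exact: measurable_ann|exact: nu_ann_lty].
move: (zn); rewrite (vG_bigcup (- n%:Z) d) -kE => -[t0 _ zt0].
have E t : cintegral nu (ann k) (fun chi => (chi (@vdigits p (- n%:Z) d t))^* * chi z)
    = if t == t0 then (p%:R ^ k : R)%:C%C else 0.
  transitivity (cintegral nu (char_coset k 1%g)
      (fun chi => chi (z - vdigits (- n%:Z) t))).
    by apply: eq_cintegral => chi _; rewrite chi_add charN mulrC.
  rewrite (cintegral_char_coset nu_haar p_prime) mul1r.
  case: asboolP => [/vballP zt|zt]; case: eqP => // tt0.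
    case: tt0; apply: (@vG_trivIset p (- n%:Z) d) => //.
    by exists z; rewrite -kE.
  by case: zt; apply/vballP; rewrite tt0.
rewrite (bigD1 t0)//= big1 ?addr0; last first.
  by move=> t tt0; rewrite E (negbTE tt0) mulr0.
by rewrite E eqxx mulrC (ball_integral_eq zt0).
Qed.

Variable phihat : X -> R[i].
Hypothesis phihatE : is_fourier mu nu phi phihat.

Lemma phihat_L2 k : sq_integrable nu (ann k) phihat.
Proof.
case: phihatE => /memL2_sq_integrable h _.
by apply: sq_integrableS h => //; exact: measurable_ann.
Qed.

Lemma phihat_conj_char_L2 k u :
  sq_integrable nu (ann k) (fun chi => (phihat chi)^* * chi u).
Proof.
have mA := @measurable_ann R p k.
apply: (sq_integrableM_bounded (B := 1) mA (eval_char_cmeasurable u mA)).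
  by move=> chi _; rewrite sqn_char.
exact/sq_integrable_conj/phihat_L2.
Qed.

Lemma cintegrable_spectral k u :
  cintegrable nu (ann k) (fun chi => (sqn (phihat chi))%:C%C * chi u).
Proof.
under eq_fun do rewrite -mulr_conj_sqn -mulrA.
apply: cintegrableM; [exact: measurable_ann|exact: phihat_L2|].
exact: phihat_conj_char_L2.
Qed.

Lemma partial_fourier_cvg k :
  (fun n => \int[nu]_(chi in ann k) sqn (partial_fourier n chi - phihat chi))
  @ \oo --> (0 : R).
Proof.
case: phihatE => _ /fine_cvgP[fin cv].
apply: (squeeze_cvgr _ (cvg_cst 0) cv).
near=> n; apply/andP; split; first by apply: Rintegral_ge0 => chi _; exact: sqn_ge0.
rewrite /Rintegral /=.
under eq_integral do rewrite -sqnE distrC.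
apply: fine_le.
- rewrite ge0_fin_numE; last by apply: integral_ge0 => chi _; rewrite lee_fin sqr_ge0.
  apply: le_lt_trans (ge0_integral_subset_le _ _ _) _.
    by move=> chi; rewrite lee_fin sqr_ge0.
  rewrite -ge0_fin_numE; last by apply: integral_ge0 => chi _; rewrite lee_fin sqr_ge0.
  by near: n.
- by near: n.
- by apply: ge0_integral_subset_le => chi; rewrite lee_fin sqr_ge0.
Unshelve. all: by end_near. Qed.

Lemma pairing_fourier k (g : X -> R[i]) : sq_integrable nu (ann k) g ->
  (fun n => complex.Re (cintegral nu (ann k) (fun chi => partial_fourier n chi * g chi)))
    @ \oo --> complex.Re (cintegral nu (ann k) (fun chi => phihat chi * g chi)) /\
  (fun n => complex.Im (cintegral nu (ann k) (fun chi => partial_fourier n chi * g chi)))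
    @ \oo --> complex.Im (cintegral nu (ann k) (fun chi => phihat chi * g chi)).
Proof.
move=> gi; apply: pairing_limit => //.
- exact: measurable_ann.
- exists (absz k) => // n /= kn; apply: partial_fourier_sq_integrable; lia.
- exact: phihat_L2.
- exact: partial_fourier_cvg.
Qed.

(** The pairings with the partial transforms do not depend on n once n is large,
    so they are equal to their limit. *)
Lemma fourier_inversion k z :
  (p%:R ^ k : R)%:C%C * ball_integral z k =
  cintegral nu (ann k) (fun chi => phihat chi * chi z).
Proof.
have [cRe cIm] : _ /\ _ := pairing_fourier
  (sq_integrable_char z (measurable_ann k) (nu_ann_lty nu_haar k)).
have [n0 zn0] := vG_exhaust z.
have ev : \forall n \near \oo,
    cintegral nu (ann k) (fun chi => partial_fourier n chi * chi z) =
    (p%:R ^ k : R)%:C%C * ball_integral z k.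
  exists (n0 + absz k)%N => // n /= kn; apply: pairing_partial_fourier_char.
    lia.
  by apply: vG_le zn0; lia.
apply: complex_eq.
  apply: cvg_unique cRe => //; apply: cvg_near_cst.
  by apply: filterS ev => n ->.
apply: cvg_unique cIm => //; apply: cvg_near_cst.
by apply: filterS ev => n ->.
Qed.

Variable M : int.
Hypothesis phihat_support : {ae nu, forall chi, ~ ann M chi -> phihat chi = 0}.

(** The value that the inversion formula predicts for phi on the ball of [z] of
    level M. *)
Definition sample z : R[i] :=
  cintegral nu (ann M) (fun chi => phihat chi * chi z).

Lemma ball_integral_sample k z : M <= k ->
  ball_integral z k = (p%:R ^ (- k) : R)%:C%C * sample z.
Proof.
move=> Mk; rewrite /sample -(@cintegral_support _ _ _ nu (ann k) (ann M)).
- rewrite -fourier_inversion mulrA -rmorphM/= -expfzDr; last first.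
    by rewrite pnatr_eq0 -lt0n prime_gt0.
  by rewrite addNr expr0z mul1r.
- exact: measurable_ann.
- exact: measurable_ann.
- by move=> chi h x xk; apply: h; exact: vG_le xk.
- apply: cintegrableM; [exact: measurable_ann|exact: phihat_L2|].
  by apply: sq_integrable_char; [exact: measurable_ann|exact: nu_ann_lty].
- by apply: ae_impl phihat_support => chi h _ /h ->; rewrite mul0r.
Qed.

Lemma sample_vball z y : vball y M z -> sample z = sample y.
Proof.
by move=> yz; apply: eq_cintegral => chi chiM; rewrite (annihilator_vball chiM yz).
Qed.

(** The integrals of phi over all balls inside the ball of [y] are those of the
    constant [sample y]. *)
Lemma phi_locally_constant y :
  {ae mu, forall x, vball y M x -> phi x = sample y}.
Proof.
have mb z k := @measurable_vball p z k.
have [i1 i2] := cintegrable_phi_vball y M.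
have icst (c : R) : mu.-integrable (vball y M : set (borel G)) (EFin \o (fun=> c)).
  by apply: rintegrable_cst => //; exact: mu_vball_lty.
(* P stands for the real and for the imaginary part. *)
have key z k (P : R[i] -> R) : vball y M z -> M <= k ->
    (forall D, cintegrable mu D phi -> mu.-integrable D (EFin \o (fun x => P (phi x)))) ->
    \int[mu]_(x in vball z k) P (phi x) = p%:R ^ (- k) * P (sample y) ->
    \int[mu]_(x in vball z k) (P (phi x) - P (sample y)) = 0.
  move=> zy Mk iP PE.
  rewrite RintegralB//; first last.
  - by apply: rintegrable_cst => //; exact: mu_vball_lty.
  - exact/iP/cintegrable_phi_vball.
  rewrite PE Rintegral_cst//.
  by rewrite [fine _](_ : _ = p%:R ^ (- k)) ?mu_vball// mulrC subrr.
have hRe : {ae mu, forall x, vball y M x ->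
    complex.Re (phi x) - complex.Re (sample y) = 0}.
  apply: ae_eq0_vball; first exact: (integrableB (mb y M) i1 (icst _)).
  move=> z k zy Mk; apply: (key z k (@complex.Re R)) => //; first by move=> D [].
  have /(congr1 (@complex.Re R)) := ball_integral_sample z Mk.
  by rewrite (sample_vball zy) cReM /= mul0r subr0.
have hIm : {ae mu, forall x, vball y M x ->
    complex.Im (phi x) - complex.Im (sample y) = 0}.
  apply: ae_eq0_vball; first exact: (integrableB (mb y M) i2 (icst _)).
  move=> z k zy Mk; apply: (key z k (@complex.Im R)) => //; first by move=> D [].
  have /(congr1 (@complex.Im R)) := ball_integral_sample z Mk.
  by rewrite (sample_vball zy) cImM /= mul0r addr0.
apply: ae_impl2 hRe hIm => x hr hi xy.
by apply: complex_eq; apply/eqP; rewrite -subr_eq0 ?hr ?hi.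
Qed.

Lemma phi_shift_L2 u : @sq_integrable _ _ (borel G) mu setT (fun x => phi (x - u)).
Proof.
exact: (sq_integrable_preserving (vtranslation_measurable u)
  (@vtranslation_haar _ _ _ mu_haar u) measurableT phi_L2).
Qed.

Lemma cintegrable_correlation (D : set (borel G)) u : measurable D ->
  cintegrable mu D (fun x => phi x * (phi (x - u))^*).
Proof.
move=> mD; apply: (@cintegrableS _ _ _ _ setT) => //.
apply: cintegrableM => //; apply: sq_integrable_conj; exact: phi_shift_L2.
Qed.

(** Both sides are the same finite sum over the cosets of G_M in G_(-n): on such
    a coset phi and its shift are constant almost everywhere, and the value of
    the shift is the pairing of phihat with [chi (y - u)]. *)
Lemma windowed_correlation (n : nat) u : - n%:Z <= M ->
  cintegral mu (vG (- n%:Z)) (fun x => phi x * (phi (x - u))^*) =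
  cintegral nu (ann M) (fun chi =>
    partial_fourier n chi * ((phihat chi)^* * chi u)).
Proof.
move=> /int_offset[d ME]; have mA := @measurable_ann R p M.
have sqg := phihat_conj_char_L2 M u; have sqh := phihat_L2 M.
have sqc z := sq_integrable_char z mA (nu_ann_lty nu_haar M).
rewrite (pairing_partial_fourier ME sqg) (vG_bigcup (- n%:Z) d) -ME.
rewrite cintegral_bigcup_fin; last first.
- apply: cintegrable_correlation; rewrite ME -vG_bigcup; exact: measurable_vG.
- by rewrite ME; exact: vG_trivIset.
- by move=> t; exact: measurable_vball.
apply: eq_bigr => t _; set y := vdigits _ t.
have -> : cintegral nu (ann M) (fun chi => (chi y)^* * ((phihat chi)^* * chi u)) =
    (sample (y - u))^*.
  rewrite -cintegral_conj//; last exact: cintegrableM.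
  apply: eq_cintegral => chi _.
  by rewrite rmorphM/= chi_add charN rmorphM/= conjCK mulrCA.
rewrite (ball_integral_sample y (lexx M)).
rewrite (@ae_eq_cintegral _ _ _ mu _ _ (fun=> sample y * (sample (y - u))^*)).
- rewrite cintegral_cst; last exact: measurable_vball.
  by rewrite mu_vball//= mulrC mulrA.
- exact: measurable_vball.
- have := cintegrable_correlation u (measurable_vball y M).
  by apply: cintegrable_measurable; exact: measurable_vball.
- exact: cmeasurable_cst.
- have ae_shift := ae_preserving (vtranslation_measurable u)
    (@vtranslation_haar _ _ _ mu_haar u) (phi_locally_constant (y - u)).
  apply: ae_impl2 (phi_locally_constant y) ae_shift => x h1 h2 xy.
  rewrite h1// h2//; apply/vball_shift; by rewrite subrK.
Qed.

(** The limit of [windowed_correlation]: the windows exhaust the group on one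
    side, the partial transforms tend to phihat on the other. *)
Lemma correlation_spectral u :
  inner2 mu phi (fun x => phi (x - u)) =
  cintegral nu (ann M) (fun chi => (sqn (phihat chi))%:C%C * chi u).
Proof.
have sqg := phihat_conj_char_L2 M u.
have -> : cintegral nu (ann M) (fun chi => (sqn (phihat chi))%:C%C * chi u) =
    cintegral nu (ann M) (fun chi => phihat chi * ((phihat chi)^* * chi u)).
  by apply: eq_cintegral => chi _; rewrite mulrA mulr_conj_sqn.
have [lRe lIm] := pairing_fourier sqg.
have exh x : \forall n \near \oo, vG (- n%:Z) x.
  have [n xn] := vG_exhaust x; exists n => // m /= nm.
  by apply: vG_le xn; rewrite lerN2 lez_nat.
have [eRe eIm] := @cintegral_exhaust _ _ (borel G) mu (fun n => vG (- n%:Z)) _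
  (fun n => measurable_vG (- n%:Z)) exh (cintegrable_correlation u measurableT).
have ev : \forall n \near \oo,
    cintegral mu (vG (- n%:Z)) (fun x => phi x * (phi (x - u))^*) =
    cintegral nu (ann M) (fun chi =>
      partial_fourier n chi * ((phihat chi)^* * chi u)).
  by exists (absz M) => // n /= Mn; apply: windowed_correlation; lia.
apply: complex_eq.
  apply: (cvg_unique _ eRe) => //; apply: cvg_trans lRe; apply: near_eq_cvg.
  by apply: filterS ev => n ->.
apply: (cvg_unique _ eIm) => //; apply: cvg_trans lIm; apply: near_eq_cvg.
by apply: filterS ev => n ->.
Qed.

End Fourier.

Lemma sqn_norm_indic (R : realType) (T : Type) (E : set T) (x : T) (z : R[i]) :
  `|z| = (\1_E x : R)%:C%C -> sqn z = \1_E x.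
Proof.
by move=> zE; rewrite -sqnE zE /= indicE; case: (x \in E); rewrite ?expr1n ?expr0n.
Qed.

Theorem theorem3p2 (R : realType) (p : nat) (p_prime : prime p) (N M : nat)
  (mu : {measure set (borel (vilenkin p)) -> \bar R}) (mu_haar : haarG mu)
  (nu : {measure set (borel (character R p)) -> \bar R}) (nu_haar : haarX nu)
  (E : set (character R p)) (E_sub : E `<=` annihilator R p M%:Z)
  (E_elem : elementary p_prime N M E)
  (phi : vilenkin p -> R[i]) (phi_L2 : memL2 mu phi)
  (phihat : character R p -> R[i]) (phihatE : is_fourier mu nu phi phihat)
  (phihat_abs : {ae nu, forall chi, `|phihat chi| = ((\1_E chi : R)%:C)%C}) :
  orthonormal_system mu (vH0 p) (fun h x => phi (x - h)).
Proof.
have phi_sq := memL2_sq_integrable phi_L2.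
have cor_int := cintegrable_correlation mu_haar phi_sq.
split=> [h _|h g h0 g0].
  exact/sq_integrable_memL2/(phi_shift_L2 mu_haar phi_sq).
have supp : {ae nu, forall chi, ~ annihilator R p M%:Z chi -> phihat chi = 0}.
  apply: ae_impl phihat_abs => chi chiE chiM; apply/eqP; rewrite -normr_eq0 chiE.
  by rewrite indicE memNset// => /E_sub.
have mA := @measurable_ann R p M%:Z.
have mE := elementary_measurable E_elem.
set u := g - h.
have u0 : vH0 p u by move=> k k0; rewrite vilenkinD vilenkinN h0// g0// subrr.
have iA := cintegrable_spectral phihatE M%:Z u.
(* The translation by h moves one of the two shifts back to phi. *)
transitivity (inner2 mu phi (fun x => phi (x - u))).
  rewrite /inner2 -(cintegral_preserving (vtranslation_measurable h)
    (@vtranslation_haar _ _ _ mu_haar h) measurableT (cor_int _ u measurableT)).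
  apply: eq_cintegral => x _; congr (_ * (phi _)^*).
  by rewrite /u opprB addrA subrK.
rewrite (correlation_spectral p_prime mu_haar nu_haar phi_sq phihatE supp).
rewrite (cintegral_support mA mE E_sub iA); last first.
  apply: ae_impl phihat_abs => chi abs_chi _ Echi; have chiE := sqn_norm_indic abs_chi.
  by rewrite chiE indicE memNset// mul0r.
have iE := cintegrableS mA mE E_sub iA.
rewrite (@ae_eq_cintegral _ _ _ nu _ _ (fun chi => chi u) mE).
- rewrite (cintegral_char_elementary nu_haar E_sub E_elem u0).
  by rewrite /u subr_eq0 eq_sym.
- exact: cintegrable_measurable iE.
- exact: eval_char_cmeasurable.
- apply: ae_impl phihat_abs => chi abs_chi Echi; have chiE := sqn_norm_indic abs_chi.
  by rewrite chiE indicE mem_set// mul1r.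
Qed.
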